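(* Let $d,D\in\mathbb{N}$ and let $A_1,\dots,A_d\in\mathbb{M}_D(\mathbb{C})$ satisfy $\sum_{i=1}^d A_iA_i^\dagger=\mathbf{1}_D$, so that $\Phi(M)=\sum_{i=1}^d A_i^\dagger M A_i$ is a quantum channel (completely positive and trace preserving) on $\mathbb{M}_D(\mathbb{C})$. Suppose the Markov-Dobrushin constant of $\Phi$ satisfies $\kappa_\Phi>0$. Then the sequence of states $\{\varphi_n\}_n$ associated with the translation-invariant matrix product state defined by $\{A_i\}$ converges to a unique limiting state $\varphi$ on $\mathcal{B}_{\mathbb{N}}$: for every $N\in\mathbb{N}$ and every $X\in\mathcal{B}_{[1,N]}$, $\lim_{n\to\infty}\varphi_n(X)=\varphi(X)$, where $$\varphi(X)=\sum_{\alpha,\beta=1}^{D} \big(e_\alpha^\dagger\rho_* e_\beta\big)\,\operatorname{Tr}\big(\hat X(e_\alpha e_\beta^\dagger)\big),$$ and $\rho_*$ is the unique invariant state of $\Phi$ in the set $\mathfrak{S}_D$ of $D\times D$ density matrices.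
   Context: $\mathcal{H}$ is a $d$-dimensional Hilbert space with orthonormal basis $\{|i\rangle\}_{i=1}^d$. $\mathcal{B}_{[1,n]}=\mathcal{B}(\mathcal{H})^{\otimes n}\cong\mathcal{B}(\mathcal{H}^{\otimes n})$ is embedded in $\mathcal{B}_{[1,n+1]}$ by $X\mapsto X\otimes\mathbf{1}_{n+1}$. $\mathcal{B}_{\mathbb{N}}$ is the infinite tensor product C$^*$-algebra, i.e. the norm closure of $\bigcup_n\mathcal{B}_{[1,n]}$. For $X\in\mathcal{B}_{[1,N]}$ and $n\ge N$, $\varphi_n(X)$ means $\varphi_n$ evaluated on $X\otimes\mathbf{1}$ in $\mathcal{B}_{[1,n]}$. A state is a normalized positive linear functional. Matrix product vectors: $|\Psi_n\rangle=\sum_{i_1,\dots,i_n=1}^d\operatorname{Tr}(A_{i_1}\cdots A_{i_n})|i_1,\dots,i_n\rangle$, and $$\varphi_n(X)=\frac{\langle\Psi_{n+1}|X\otimes\mathbf{1}_{n+1}|\Psi_{n+1}\rangle}{\langle\Psi_{n+1}|\Psi_{n+1}\rangle},\qquad X\in\mathcal{B}_{[1,n]},$$ where it is assumed that $\langle\Psi_{n+1}|\Psi_{n+1}\rangle\ne0$ for all $n\geq 1$ so that $\varphi_n$ is defined. For $X\in\mathcal{B}_{[1,N]}$, $\hat X:\mathbb{M}_D(\mathbb{C})\to\mathbb{M}_D(\mathbb{C})$ is $$\hat X(M)=\sum_{\substack{i_1,\dots,i_N\\ j_1,\dots,j_N}}\langle i_1,\dots,i_N|X|j_1,\dots,j_N\rangle\,A_{i_N}^{\dagger}\cdots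 A_{i_1}^{\dagger}\,M\,A_{j_1}\cdots A_{j_N}.$$ $\{e_\alpha\}_{\alpha=1}^D$ is the standard basis of $\mathbb{C}^D$, and $\operatorname{Tr}$ is the usual unnormalized matrix trace. $\mathfrak{S}_D$ is the set of positive semidefinite matrices in $\mathbb{M}_D(\mathbb{C})$ with trace $1$; $\rho$ is invariant if $\Phi(\rho)=\rho$. Markov-Dobrushin constant: $\kappa_\Phi=\inf\{\Phi(\xi\xi^\dagger):\xi\in\mathbb{C}^D,\ \|\xi\|=1\}$, where the infimum of a family $\{M_i\}$ of Hermitian matrices is its greatest lower bound, i.e. the largest $B$ with $B\le M_i$ for all $i$, in the Loewner order ($B\le M$ iff $M-B$ is positive semidefinite). The hypothesis $\kappa_\Phi>0$ means that this greatest lower bound exists and is a nonzero positive semidefinite matrix. *)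

(* Defs.v *)
From HB Require Import structures.
From mathcomp Require Import all_boot all_order all_algebra.
From mathcomp Require Import all_classical all_reals all_analysis.
From mathcomp Require Import complex.

Set Implicit Arguments.
Unset Strict Implicit.
Unset Printing Implicit Defensive.

Import Order.TTheory GRing.Theory Num.Theory.
Import numFieldNormedType.Exports.

Local Open Scope classical_set_scope.
Local Open Scope quotient_scope.
Local Open Scope ring_scope.
Local Open Scope sesquilinear_scope.

Section Norms.
Variable R : realType.
Notation C := R[i].

(* The norm sqrt(<v|v>) of C^n.  The square root is taken in R[i] and is real. *)
Definition l2norm n (v : 'cV[C]_n) : R := complex.Re (sqrtC ((v^t* *m v) 0 0)).

(* The operator norm, which is the C*-norm of a matrix algebra. *)
Definition opnorm m n (X : 'M[C]_(m, n)) : R :=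
  sup [set l2norm (X *m v) | v in [set v | l2norm v <= 1]].

Lemma rcM (x y : R) : (x * y)%:C%C = x%:C%C * y%:C%C.
Proof. exact: rmorphM. Qed.

Lemma rcX (x : R) k : (x ^+ k)%:C%C = x%:C%C ^+ k.
Proof. exact: rmorphXn. Qed.

Lemma normCE (a : C) : (complex.Re `|a|)%:C%C = `|a|.
Proof. exact/RRe_real/normr_real. Qed.

Lemma normC_ge0 (a : C) : 0 <= complex.Re `|a|.
Proof. by rewrite -ler0c normCE. Qed.

Lemma dotE n (u v : 'cV[C]_n) : (u^t* *m v) 0 0 = dotmx v^T u^T.
Proof.
rewrite dotmxE trmxK !mxE; apply: eq_bigr => i _.
by rewrite !mxE mulrC.
Qed.

Lemma l2normE n (v : 'cV[C]_n) : (l2norm v)%:C%C = sqrtC (dotmx v^T v^T).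
Proof.
by rewrite /l2norm dotE RRe_real // ger0_real // sqrtC_ge0 dnorm_ge0.
Qed.

Lemma l2norm_ge0 n (v : 'cV[C]_n) : 0 <= l2norm v.
Proof. by rewrite -ler0c l2normE sqrtC_ge0 dnorm_ge0. Qed.

Lemma l2norm_eq0 n (v : 'cV[C]_n) : l2norm v = 0 -> v = 0.
Proof.
move=> h; have : (l2norm v)%:C%C == 0 :> C by rewrite h.
by rewrite l2normE sqrtC_eq0 dnorm_eq0 => /eqP/(congr1 trmx); rewrite trmxK trmx0.
Qed.

Lemma l2norm0 n : l2norm (0 : 'cV[C]_n) = 0.
Proof. by apply: complexI; rewrite l2normE trmx0 linear0l sqrtC0. Qed.

Lemma l2normD n (u v : 'cV[C]_n) : l2norm (u + v) <= l2norm u + l2norm v.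
Proof.
rewrite -lecR rmorphD /= !l2normE linearD /=.
exact: (triangle_lerif (@dotmx _ _) u^T v^T).1.
Qed.

Lemma l2normZ n (a : C) (v : 'cV[C]_n) : l2norm (a *: v) = complex.Re `|a| * l2norm v.
Proof.
apply: complexI; rewrite rcM !l2normE linearZ /= dnormZ normCE.
by rewrite sqrtCM ?nnegrE ?exprn_ge0 ?dnorm_ge0 // sqrCK.
Qed.

Lemma l2normN n (v : 'cV[C]_n) : l2norm (- v) = l2norm v.
Proof. by rewrite -scaleN1r l2normZ normrN1 mul1r. Qed.

Lemma l2norm_CS n (u v : 'cV[C]_n) :
  complex.Re `|(u^t* *m v) 0 0| <= l2norm u * l2norm v.
Proof.
rewrite -lecR rcM normCE !l2normE dotE mulrC.
exact: (CauchySchwarz_sqrt (@dotmx _ _) v^T u^T).1.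
Qed.

Lemma l2norm_sqr n (v : 'cV[C]_n) :
  ((l2norm v) ^+ 2)%:C%C = \sum_i `|v i 0| ^+ 2.
Proof.
rewrite rcX l2normE sqrtCK -dotE mxE.
by apply: eq_bigr => i _; rewrite !mxE mulrC normCK.
Qed.

Lemma l2norm_sum n (I : finType) (F : I -> 'cV[C]_n) :
  l2norm (\sum_i F i) <= \sum_i l2norm (F i).
Proof.
elim/big_rec2: _ => [|i y x _ h]; first by rewrite l2norm0.
by apply: le_trans (l2normD _ _) _; rewrite lerD2l.
Qed.

Lemma l2norm_coord n (v : 'cV[C]_n) i : complex.Re `|v i 0| <= l2norm v.
Proof.
rewrite -(@ler_pXn2r _ 2) ?nnegrE ?l2norm_ge0 ?normC_ge0 //.
rewrite -lecR l2norm_sqr rcX normCE.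
by rewrite (bigD1 i) //= lerDl sumr_ge0 // => j _; rewrite exprn_ge0.
Qed.

Lemma opnorm_bounded m n (X : 'M[C]_(m, n)) :
  exists2 c, 0 <= c & forall v, l2norm (X *m v) <= c * l2norm v.
Proof.
exists (\sum_j l2norm (col j X)) => [|v]; first exact: sumr_ge0 (fun _ _ => l2norm_ge0 _).
have -> : X *m v = \sum_j v j 0 *: col j X.
  apply/colP => i; rewrite mxE summxE; apply: eq_bigr => j _.
  by rewrite !mxE mulrC.
apply: le_trans (l2norm_sum _) _; rewrite mulr_suml; apply: ler_sum => j _.
by rewrite l2normZ mulrC ler_wpM2l ?l2norm_ge0 // l2norm_coord.
Qed.

Lemma opnorm_le m n (X : 'M[C]_(m, n)) c : 0 <= c ->
  (forall v, l2norm (X *m v) <= c * l2norm v) -> opnorm X <= c.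
Proof.
move=> c0 h; apply: ge_sup.
  by exists (l2norm (X *m 0)); exists 0 => //=; rewrite l2norm0.
move=> _ [v /= v1 <-]; apply: le_trans (h v) _.
by rewrite -[leRHS]mulr1 ler_wpM2l.
Qed.

Lemma opnorm_ub1 m n (X : 'M[C]_(m, n)) v : l2norm v <= 1 ->
  l2norm (X *m v) <= opnorm X.
Proof.
move=> v1; have [c c0 h] := opnorm_bounded X.
apply: ub_le_sup; last by exists v.
exists c => _ [w /= w1 <-]; apply: le_trans (h w) _.
by rewrite -[leRHS]mulr1 ler_wpM2l.
Qed.

Lemma opnorm_ge0 m n (X : 'M[C]_(m, n)) : 0 <= opnorm X.
Proof.
by apply: le_trans (@opnorm_ub1 _ _ X 0 _); rewrite ?l2norm_ge0 ?l2norm0.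
Qed.

Lemma opnormP m n (X : 'M[C]_(m, n)) v : l2norm (X *m v) <= opnorm X * l2norm v.
Proof.
have [/l2norm_eq0 ->|v0] := eqVneq (l2norm v) 0.
  by rewrite mulmx0 !l2norm0 mulr0.
have vp : 0 < l2norm v by rewrite lt_def v0 l2norm_ge0.
rewrite -ler_pdivrMr // mulrC.
have e : complex.Re `|((l2norm v)^-1)%:C%C| = (l2norm v)^-1.
  by rewrite ger0_norm // ler0c invr_ge0 l2norm_ge0.
rewrite -e -l2normZ scalemxAr opnorm_ub1 // l2normZ e mulVf //.
Qed.

Lemma opnorm0 m n : opnorm (0 : 'M[C]_(m, n)) = 0.
Proof.
apply/eqP; rewrite eq_le opnorm_ge0 andbT.
by apply: opnorm_le => // v; rewrite mul0mx l2norm0 mul0r.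
Qed.

Lemma opnormD m n (X Y : 'M[C]_(m, n)) : opnorm (X + Y) <= opnorm X + opnorm Y.
Proof.
apply: opnorm_le => [|v]; first by rewrite addr_ge0 ?opnorm_ge0.
by rewrite mulmxDl mulrDl (le_trans (l2normD _ _)) // lerD ?opnormP.
Qed.

Lemma opnormZ_le m n (a : C) (X : 'M[C]_(m, n)) :
  opnorm (a *: X) <= complex.Re `|a| * opnorm X.
Proof.
have a0 := normC_ge0 a.
apply: opnorm_le => [|v]; first by rewrite mulr_ge0 ?opnorm_ge0.
by rewrite -scalemxAl l2normZ -mulrA ler_wpM2l ?opnormP.
Qed.

Lemma opnormN m n (X : 'M[C]_(m, n)) : opnorm (- X) = opnorm X.
Proof.
have h (Y : 'M[C]_(m, n)) : opnorm (- Y) <= opnorm Y.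
  apply: opnorm_le => [|v]; first exact: opnorm_ge0.
  by rewrite mulNmx l2normN opnormP.
apply: le_anti; apply/andP; split; first exact: h.
by have := h (- X); rewrite (opprK X).
Qed.

Lemma opnormM m n p (X : 'M[C]_(m, n)) (Y : 'M[C]_(n, p)) :
  opnorm (X *m Y) <= opnorm X * opnorm Y.
Proof.
apply: opnorm_le => [|v]; first by rewrite mulr_ge0 ?opnorm_ge0.
rewrite -mulmxA (le_trans (opnormP _ _)) // -mulrA ler_wpM2l ?opnormP //.
exact: opnorm_ge0.
Qed.

Lemma opnorm_adj_le m n (X : 'M[C]_(m, n)) : opnorm (X^t* ) <= opnorm X.
Proof.
apply: opnorm_le => [|v]; first exact: opnorm_ge0.
move E : (X^t* *m v) => w.
have [->|w0] := eqVneq (l2norm w) 0.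
  by rewrite mulr_ge0 ?opnorm_ge0 ?l2norm_ge0.
have wp : 0 < l2norm w by rewrite lt_def w0 l2norm_ge0.
have e : (l2norm w ^+ 2)%:C%C = (v^t* *m (X *m w)) 0 0.
  have wE : w^t* = v^t* *m X by rewrite -E trmx_mul map_mxM /= trmxCK.
  by rewrite rcX l2normE sqrtCK -dotE wE -(mulmxA _ X w).
have e2 : l2norm w ^+ 2 = complex.Re `|(v^t* *m (X *m w)) 0 0|.
  by rewrite -e ger0_norm // ler0c exprn_ge0 ?l2norm_ge0.
rewrite -(ler_pM2r wp) -[leLHS]expr2 e2 (le_trans (l2norm_CS _ _)) //.
by rewrite mulrC mulrAC ler_wpM2r ?l2norm_ge0 // opnormP.
Qed.

End Norms.

Section LocalAlgebras.
Variables (R : realType) (d : nat).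
Notation C := R[i].

(* Multi-indices (i_1, ..., i_n), labelling the product basis of the n-fold
   tensor power of a d-dimensional Hilbert space. *)
Definition conf n := {ffun 'I_n -> 'I_d}.

(* B_[1,n]: matrices with respect to the product basis, which is numbered by
   enum_rank. *)
Definition loc n := 'M[C]_#|{: conf n}|.

Definition braket n (s : conf n) (X : loc n) (t : conf n) : C :=
  X (enum_rank s) (enum_rank t).

Definition kernel_op n (f : conf n -> conf n -> C) : loc n :=
  \matrix_(a, b) f (enum_val a) (enum_val b).

Definition restrict N n (h : (N <= n)%N) (s : conf n) : conf N :=
  [ffun k => s (widen_ord h k)].

(* X |-> X (x) 1 (x) ... (x) 1 from B_[1,N] to B_[1,n]: the matrix element is
   <s_1..s_N| X |t_1..t_N> times the Kronecker deltas of the last n - N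
   indices. *)
Definition emb N n (h : (N <= n)%N) (X : loc N) : loc n :=
  kernel_op (fun s t => braket (restrict h s) X (restrict h t)
    *+ [forall k : 'I_n, (N <= k)%N ==> (s k == t k)]).

Lemma braket_kernel n f (s t : conf n) : braket s (kernel_op f) t = f s t.
Proof. by rewrite /braket mxE !enum_rankK. Qed.

Lemma locP n (X Y : loc n) :
  (forall s t, braket s X t = braket s Y t) -> X = Y.
Proof.
move=> h; apply/matrixP => a b.
by have := h (enum_val a) (enum_val b); rewrite /braket !enum_valK.
Qed.

Lemma sum_conf (V : nmodType) n (F : 'I_#|{: conf n}| -> V) :
  \sum_a F a = \sum_(s : conf n) F (enum_rank s).
Proof. by rewrite (reindex enum_rank) //; apply/onW_bij/enum_rank_bij. Qed.

Lemma braketM n (X Y : loc n) s t :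
  braket s (X *m Y) t = \sum_u braket s X u * braket u Y t.
Proof. by rewrite /braket mxE sum_conf. Qed.

Lemma braket_linear n a (X Y : loc n) s t :
  braket s (a *: X + Y) t = a * braket s X t + braket s Y t.
Proof. by rewrite /braket !mxE. Qed.

Lemma braket_adj n (X : loc n) s t : braket s (X^t* ) t = (braket t X s)^*.
Proof. by rewrite /braket !mxE. Qed.

Section Emb.
Variables (N n : nat) (h : (N <= n)%N).

Definition conf_tail (s : conf n) : {ffun 'I_(n - N) -> 'I_d} :=
  [ffun j => s (cast_ord (subnKC h) (rshift N j))].

Definition conf_glue (p : {ffun 'I_(n - N) -> 'I_d}) (q : conf N) : conf n :=
  [ffun k => match fintype.split (cast_ord (esym (subnKC h)) k) with
             | inl i => q i | inr j => p j end].

Lemma restrict_glue p q : restrict h (conf_glue p q) = q.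
Proof.
apply/ffunP => i; rewrite !ffunE.
have -> : cast_ord (esym (subnKC h)) (widen_ord h i) = unsplit (inl i).
  exact: val_inj.
by rewrite unsplitK.
Qed.

Lemma tail_glue p q : conf_tail (conf_glue p q) = p.
Proof.
apply/ffunP => i; rewrite !ffunE cast_ordK.
have -> : rshift N i = unsplit (inr i) by [].
by rewrite unsplitK.
Qed.

Lemma glueK s : conf_glue (conf_tail s) (restrict h s) = s.
Proof.
apply/ffunP => i; rewrite !ffunE.
case: split_ordP => j E; rewrite ffunE; congr (s _); apply: val_inj;
  by have := congr1 val E.
Qed.

Lemma tail_eq (s t : conf n) :
  [forall k : 'I_n, (N <= k)%N ==> (s k == t k)] = (conf_tail s == conf_tail t).
Proof.
apply/forallP/eqP => [H|E k].
  apply/ffunP => j; rewrite !ffunE.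
  by have /implyP := H (cast_ord (subnKC h) (rshift N j)); rewrite leq_addr => /(_ isT)/eqP.
apply/implyP => Nk; rewrite -(glueK s) -(glueK t) E !ffunE.
case: split_ordP => j //= /(congr1 val) /= kj.
by move: Nk; rewrite kj leqNgt ltn_ord.
Qed.

Lemma sum_glue (V : nmodType) (F : conf n -> V) :
  \sum_s F s = \sum_p \sum_q F (conf_glue p q).
Proof.
rewrite pair_big /= (reindex (fun x => conf_glue x.1 x.2)) //.
exists (fun s => (conf_tail s, restrict h s)) => [[p q] _|s _] /=.
  by rewrite tail_glue restrict_glue.
exact: glueK.
Qed.

Lemma braket_glue (X : loc N) p q p' q' :
  braket (conf_glue p q) (emb h X) (conf_glue p' q') = braket q X q' *+ (p == p').
Proof.
by rewrite braket_kernel tail_eq !tail_glue !restrict_glue.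
Qed.

Lemma embP (X Y : loc n) :
  (forall p q p' q', braket (conf_glue p q) X (conf_glue p' q')
     = braket (conf_glue p q) Y (conf_glue p' q')) -> X = Y.
Proof. by move=> H; apply: locP => s t; rewrite -(glueK s) -(glueK t). Qed.

Lemma embM (X Y : loc N) : emb h (X *m Y) = emb h X *m emb h Y.
Proof.
apply: embP => p q p' q'; rewrite braketM sum_glue braket_glue.
rewrite (bigD1 p) //= [X in _ + X]big1 ?addr0; last first.
  move=> p2 /negPf np; apply: big1 => q2 _.
  by rewrite !braket_glue eq_sym np mulr0n mul0r.
under eq_bigr do rewrite !braket_glue eqxx mulr1n.
by rewrite braketM; case: eqP => _; rewrite ?mulr1n // mulr0n big1 // => ? _; rewrite mulr0n mulr0.
Qed.

Lemma emb1 : emb h (1%:M) = 1%:M.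
Proof.
have b1 k (s t : conf k) : braket s 1%:M t = (s == t)%:R.
  by rewrite /braket mxE (inj_eq enum_rank_inj).
apply: embP => p q p' q'; rewrite braket_glue !b1.
have [->|/eqP np] := eqVneq p p'.
  have [->|/eqP nq] := eqVneq q q'; first by rewrite eqxx.
  suff /negPf -> : conf_glue p' q != conf_glue p' q' by [].
  by apply/eqP => E; apply: nq; rewrite -(restrict_glue p' q) E restrict_glue.
suff /negPf -> : conf_glue p q != conf_glue p' q' by [].
by apply/eqP => E; apply: np; rewrite -(tail_glue p q) E tail_glue.
Qed.

Lemma emb_is_linear : linear (emb h).
Proof.
move=> a X Y; apply: embP => p q p' q'; rewrite braket_linear !braket_glue.
rewrite braket_linear; case: (p == p'); rewrite ?mulr1n //.
by rewrite !mulr0n mulr0 addr0.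
Qed.

HB.instance Definition _ :=
  GRing.isLinear.Build C (loc N) (loc n) _ (emb h) emb_is_linear.

Lemma emb_adj (X : loc N) : emb h (X^t* ) = (emb h X)^t*.
Proof.
apply: embP => p q p' q'; rewrite braket_adj !braket_glue.
by rewrite braket_adj eq_sym; case: (_ == _); rewrite ?mulr1n // !mulr0n rmorph0.
Qed.

Lemma opnorm_emb (X : loc N) : opnorm (emb h X) <= opnorm X.
Proof.
pose slice p (v : 'cV[C]_#|{: conf n}|) : 'cV[C]_#|{: conf N}| :=
  \col_a v (enum_rank (conf_glue p (enum_val a))) 0.
have nE v : l2norm v ^+ 2 = \sum_p l2norm (slice p v) ^+ 2.
  apply: complexI; rewrite rmorph_sum /= [LHS]l2norm_sqr sum_conf sum_glue.
  apply: eq_bigr => p _; rewrite [RHS]l2norm_sqr sum_conf.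
  by apply: eq_bigr => q _; rewrite mxE enum_rankK.
have sE p v : slice p (emb h X *m v) = X *m slice p v.
  apply/colP => a; rewrite !mxE !sum_conf sum_glue (bigD1 p) //=.
  rewrite [X in _ + X]big1 ?addr0; last first.
    move=> p2 /negPf np; apply: big1 => q2 _.
    by rewrite -[emb _ _ _ _]/(braket _ _ _) braket_glue eq_sym np mulr0n mul0r.
  apply: eq_bigr => q _; rewrite -[emb _ _ _ _]/(braket _ _ _) braket_glue.
  by rewrite eqxx mulr1n mxE enum_rankK /braket enum_valK.
apply: opnorm_le => [|v]; first exact: opnorm_ge0.
rewrite -(@ler_pXn2r _ 2) ?nnegrE ?mulr_ge0 ?opnorm_ge0 ?l2norm_ge0 //.
rewrite nE exprMn (nE v) mulr_sumr; apply: ler_sum => p _.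
rewrite sE -exprMn ler_pXn2r ?nnegrE ?mulr_ge0 ?opnorm_ge0 ?l2norm_ge0 //.
exact: opnormP.
Qed.

End Emb.

Lemma emb_comp N n m (h1 : (N <= n)%N) (h2 : (n <= m)%N) (h3 : (N <= m)%N) X :
  emb h2 (emb h1 X) = emb h3 X.
Proof.
have rr (s : conf m) : restrict h1 (restrict h2 s) = restrict h3 s.
  by apply/ffunP => k; rewrite !ffunE; congr (s _); apply: val_inj.
apply: locP => s t; rewrite !braket_kernel.
rewrite !rr -mulrnA mulnb; congr (_ *+ nat_of_bool _).
apply/andP/forallP => [[/forallP H1 /forallP H2] k|H].
  apply/implyP => Nk; have [nk|kn] := leqP n k; first exact: (implyP (H2 k)).
  have := H1 (Ordinal kn); rewrite /= Nk !ffunE /=.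
  have -> // : widen_ord h2 (Ordinal kn) = k by apply: val_inj.
split; apply/forallP => k; apply/implyP => Nk.
  by rewrite !ffunE; apply: (implyP (H _)).
by apply: (implyP (H _)); apply: leq_trans Nk.
Qed.

End LocalAlgebras.

Section InfiniteTensorProduct.
Variables (R : realType) (d : nat).
Notation C := R[i].
(* The C*-algebra B_N is the completion of the union of the B_[1,n] for the
   operator norm.  It is realised as the set of Cauchy sequences x with x_n in
   B_[1,n], modulo the sequences that tend to 0 in norm.  Since the local
   algebras are nested, every Cauchy sequence of local elements has the same
   limit as one of this form. *)
Notation locseq := (forall n, loc R d n).

Definition cauchy_loc (x : locseq) : Prop :=
  forall e : R, 0 < e -> exists M, forall m n (h : (m <= n)%N),
    (M <= m)%N -> opnorm (x n - emb h (x m)) < e.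

Definition null_loc (x : locseq) : Prop :=
  forall e : R, 0 < e -> exists M, forall n, (M <= n)%N -> opnorm (x n) < e.

Lemma half_pos (e : R) : 0 < e -> 0 < e / 2.
Proof. by move=> e0; rewrite divr_gt0. Qed.

Lemma cauchy_bound x : cauchy_loc x ->
  exists K : R, 0 < K /\ exists M, forall n, (M <= n)%N -> opnorm (x n) <= K.
Proof.
move=> /(_ 1 ltr01)[M H]; exists (1 + opnorm (x M)); split.
  by rewrite ltr_pwDl ?opnorm_ge0.
exists M => n Mn; rewrite -[x n](subrK (emb Mn (x M))).
apply: le_trans (opnormD _ _) _; apply: lerD; last exact: opnorm_emb.
by apply: ltW; apply: H.
Qed.

Lemma cauchy_linear a x y : cauchy_loc x -> cauchy_loc y ->
  cauchy_loc (fun n => a *: x n + y n).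
Proof.
move=> cx cy e e0; pose r := complex.Re `|a| + 1.
have r0 : 0 < r by rewrite ltr_wpDl ?normC_ge0.
have [M1 H1] := cx (e / 2 / r) (divr_gt0 (half_pos e0) r0).
have [M2 H2] := cy (e / 2) (half_pos e0).
exists (maxn M1 M2) => m n h; rewrite geq_max => /andP[h1 h2].
rewrite linearP /= opprD addrACA -scalerBr (splitr e).
rewrite (le_lt_trans (opnormD _ _)) // ler_ltD ?H2 //.
rewrite (le_trans (opnormZ_le _ _)) //.
rewrite (@le_trans _ _ (r * opnorm (x n - emb h (x m)))) //.
  by rewrite ler_wpM2r ?opnorm_ge0 // lerDl.
by rewrite mulrC -ler_pdivlMr // ltW ?H1.
Qed.

Lemma cauchy_mul x y : cauchy_loc x -> cauchy_loc y ->
  cauchy_loc (fun n => x n *m y n).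
Proof.
move=> cx cy e e0.
have [K1 [K10 [M1 B1]]] := cauchy_bound cx.
have [K2 [K20 [M2 B2]]] := cauchy_bound cy.
have [M3 H3] := cx (e / 2 / K2) (divr_gt0 (half_pos e0) K20).
have [M4 H4] := cy (e / 2 / K1) (divr_gt0 (half_pos e0) K10).
exists (maxn (maxn M1 M2) (maxn M3 M4)) => m n h.
rewrite !geq_max => /andP[/andP[h1 h2] /andP[h3 h4]].
rewrite embM (_ : _ - _ = x n *m (y n - emb h (y m))
   + (x n - emb h (x m)) *m emb h (y m)); last first.
  by rewrite mulmxBr mulmxBl addrA subrK.
rewrite (le_lt_trans (opnormD _ _)) // (splitr e) ltr_leD //.
  rewrite (le_lt_trans (opnormM _ _)) //.
  rewrite (@le_lt_trans _ _ (K1 * opnorm (y n - emb h (y m)))) //.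
    by rewrite ler_wpM2r ?opnorm_ge0 // B1 // (leq_trans h1).
  by rewrite mulrC -ltr_pdivlMr // H4.
rewrite (le_trans (opnormM _ _)) //.
rewrite (@le_trans _ _ (opnorm (x n - emb h (x m)) * K2)) //.
  rewrite ler_wpM2l ?opnorm_ge0 //; apply: le_trans (opnorm_emb _ _) _.
  exact: B2.
by rewrite -ler_pdivlMr // ltW ?H3.
Qed.

Lemma cauchy_adj x : cauchy_loc x -> cauchy_loc (fun n => (x n)^t* ).
Proof.
move=> cx e e0; have [M H] := cx e e0; exists M => m n h hM.
rewrite emb_adj (_ : _ - _ = (x n - emb h (x m))^t* ).
  by rewrite (le_lt_trans (opnorm_adj_le _)) ?H.
by rewrite linearB /= map_mxB.
Qed.

Lemma cauchy0 : cauchy_loc (fun n => 0).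
Proof.
by move=> e e0; exists 0%N => m n h _; rewrite linear0 subr0 opnorm0.
Qed.

Lemma cauchy1 : cauchy_loc (fun n => 1%:M).
Proof.
by move=> e e0; exists 0%N => m n h _; rewrite emb1 subrr opnorm0.
Qed.

Lemma null_loc0 : null_loc (fun n => 0).
Proof. by move=> e e0; exists 0%N => n _; rewrite opnorm0. Qed.

Lemma null_linear a x y : null_loc x -> null_loc y ->
  null_loc (fun n => a *: x n + y n).
Proof.
move=> cx cy e e0; pose r := complex.Re `|a| + 1.
have r0 : 0 < r by rewrite ltr_wpDl ?normC_ge0.
have [M1 H1] := cx (e / 2 / r) (divr_gt0 (half_pos e0) r0).
have [M2 H2] := cy (e / 2) (half_pos e0).
exists (maxn M1 M2) => n; rewrite geq_max => /andP[h1 h2].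
rewrite (splitr e) (le_lt_trans (opnormD _ _)) // ler_ltD ?H2 //.
rewrite (le_trans (opnormZ_le _ _)) //.
rewrite (@le_trans _ _ (r * opnorm (x n))) //.
  by rewrite ler_wpM2r ?opnorm_ge0 // lerDl.
by rewrite mulrC -ler_pdivlMr // ltW ?H1.
Qed.

Lemma null_mulr x y : cauchy_loc x -> null_loc y -> null_loc (fun n => x n *m y n).
Proof.
move=> cx ny e e0; have [K [K0 [M1 B]]] := cauchy_bound cx.
have [M2 H] := ny (e / K) (divr_gt0 e0 K0).
exists (maxn M1 M2) => n; rewrite geq_max => /andP[h1 h2].
rewrite (le_lt_trans (opnormM _ _)) // (@le_lt_trans _ _ (K * opnorm (y n))) //.
  by rewrite ler_wpM2r ?opnorm_ge0 // B.
by rewrite mulrC -ltr_pdivlMr // H.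
Qed.

Lemma null_adj x : null_loc x -> null_loc (fun n => (x n)^t* ).
Proof.
move=> nx e e0; have [M H] := nx e e0; exists M => n hM.
by rewrite (le_lt_trans (opnorm_adj_le _)) ?H.
Qed.

Lemma null_mull x y : null_loc x -> cauchy_loc y -> null_loc (fun n => x n *m y n).
Proof.
move=> nx cy; have := null_adj (null_mulr (cauchy_adj cy) (null_adj nx)).
congr null_loc; apply: functional_extensionality_dep => n.
by rewrite trmx_mul map_mxM !trmxCK.
Qed.

Lemma locseqP (x y : locseq) : (forall n, x n = y n) -> x = y.
Proof. exact: functional_extensionality_dep. Qed.

Definition cseq := {x : locseq | `[< cauchy_loc x >]}.

Definition Cseq (x : locseq) (cx : cauchy_loc x) : cseq := exist _ x (asboolT cx).

Lemma cseqP (x : cseq) : cauchy_loc (val x).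
Proof. exact/asboolP/(valP x). Qed.

Definition cseq_equiv (x y : cseq) : bool :=
  `[< null_loc (fun n => val x n - val y n) >].

Lemma cseq_equivP x y : reflect (null_loc (fun n => val x n - val y n)) (cseq_equiv x y).
Proof. exact: asboolP. Qed.

Lemma null_locN x : null_loc x -> null_loc (fun n => - x n).
Proof.
move=> nx; have := null_linear (-1) nx null_loc0.
by congr null_loc; apply: locseqP => n; rewrite addr0 scaleN1r.
Qed.

Lemma null_locD x y : null_loc x -> null_loc y -> null_loc (fun n => x n + y n).
Proof.
move=> nx ny; have := null_linear 1 nx ny.
by congr null_loc; apply: locseqP => n; rewrite scale1r.
Qed.

Lemma cseq_equiv_is_equiv : equiv_class_of cseq_equiv.
Proof.
split=> [x|x y|y x z].
- by apply/cseq_equivP; move: null_loc0; congr null_loc; apply: locseqP => n; rewrite subrr.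
- apply/cseq_equivP/cseq_equivP => /null_locN; congr null_loc;
    by apply: locseqP => n; rewrite opprB.
- move=> /cseq_equivP h1 /cseq_equivP h2; apply/cseq_equivP; move: (null_locD h1 h2).
  by congr null_loc; apply: locseqP => n; rewrite addrA subrK.
Qed.

Canonical cseq_equiv_equiv := EquivRelPack cseq_equiv_is_equiv.

(* B_N; the algebraic operations are those of representatives, term by term. *)
Definition qlocal := {eq_quot cseq_equiv}.

HB.instance Definition _ := Choice.on qlocal.
HB.instance Definition _ := EqQuotient.on qlocal.

Definition qclass (x : cseq) : qlocal := \pi_qlocal x.

Lemma qclassW (P : qlocal -> Prop) : (forall x, P (qclass x)) -> forall u, P u.
Proof. exact: quotW. Qed.

Lemma qlocalP (x y : cseq) :
  null_loc (fun n => val x n - val y n) -> qclass x = qclass y.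
Proof. by move=> h; apply/eqmodP/cseq_equivP. Qed.

Lemma qlocal_ext (x y : cseq) :
  (forall n, val x n = val y n) -> qclass x = qclass y.
Proof. by move=> h; congr qclass; apply/val_inj/locseqP. Qed.

Lemma cseq_reprP (x : cseq) : null_loc (fun n => val (repr (qclass x)) n - val x n).
Proof.
by apply/cseq_equivP; have /eqmodP : repr (\pi_qlocal x) = x %[mod qlocal]
  by rewrite reprK.
Qed.

Lemma cadd_sub (x y : cseq) : cauchy_loc (fun n => val x n + val y n).
Proof.
have := cauchy_linear 1 (cseqP x) (cseqP y).
by congr cauchy_loc; apply: locseqP => n; rewrite scale1r.
Qed.

Lemma cscale_sub a (x : cseq) : cauchy_loc (fun n => a *: val x n).
Proof.
have := cauchy_linear a (cseqP x) cauchy0.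
by congr cauchy_loc; apply: locseqP => n; rewrite addr0.
Qed.

Definition cadd (x y : cseq) := Cseq (cadd_sub x y).
Definition cscale a (x : cseq) := Cseq (cscale_sub a x).
Definition cmul (x y : cseq) := Cseq (cauchy_mul (cseqP x) (cseqP y)).
Definition cadj (x : cseq) := Cseq (cauchy_adj (cseqP x)).

Definition qadd (u v : qlocal) : qlocal := qclass (cadd (repr u) (repr v)).
Definition qscale a (u : qlocal) : qlocal := qclass (cscale a (repr u)).
Definition qmul (u v : qlocal) : qlocal := qclass (cmul (repr u) (repr v)).
Definition qstar (u : qlocal) : qlocal := qclass (cadj (repr u)).
Definition qzero : qlocal := qclass (Cseq cauchy0).
Definition qone : qlocal := qclass (Cseq cauchy1).

Lemma qaddE x y : qadd (qclass x) (qclass y) = qclass (cadd x y).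
Proof.
apply: qlocalP; move: (null_locD (cseq_reprP x) (cseq_reprP y)); congr null_loc.
by apply: locseqP => n /=; rewrite opprD addrACA.
Qed.

Lemma qscaleE a x : qscale a (qclass x) = qclass (cscale a x).
Proof.
apply: qlocalP; move: (null_linear a (cseq_reprP x) null_loc0); congr null_loc.
by apply: locseqP => n /=; rewrite addr0 scalerBr.
Qed.

Lemma qmulE x y : qmul (qclass x) (qclass y) = qclass (cmul x y).
Proof.
apply: qlocalP; move: (null_locD (null_mulr (cseqP (repr (qclass x))) (cseq_reprP y))
  (null_mull (cseq_reprP x) (cseqP y))); congr null_loc.
by apply: locseqP => n /=; rewrite mulmxBr mulmxBl addrA subrK.
Qed.

Lemma qstarE x : qstar (qclass x) = qclass (cadj x).
Proof.
apply: qlocalP; move: (null_adj (cseq_reprP x)); congr null_loc.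
by apply: locseqP => n /=; rewrite linearB /= map_mxB.
Qed.

Lemma qaddA : associative qadd.
Proof.
elim/qclassW=> x; elim/qclassW=> y; elim/qclassW=> z; rewrite !qaddE.
by apply: qlocal_ext => n /=; rewrite addrA.
Qed.

Lemma qaddC : commutative qadd.
Proof.
elim/qclassW=> x; elim/qclassW=> y; rewrite !qaddE.
by apply: qlocal_ext => n /=; rewrite addrC.
Qed.

Lemma qadd0 : left_id qzero qadd.
Proof.
by elim/qclassW=> x; rewrite qaddE; apply: qlocal_ext => n /=; rewrite add0r.
Qed.

Lemma qaddN : left_inverse qzero (qscale (-1)) qadd.
Proof.
elim/qclassW=> x; rewrite qscaleE qaddE.
by apply: qlocal_ext => n /=; rewrite scaleN1r addNr.
Qed.

HB.instance Definition _ :=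
  GRing.isZmodule.Build qlocal qaddA qaddC qadd0 qaddN.

Lemma qmulA : associative qmul.
Proof.
elim/qclassW=> x; elim/qclassW=> y; elim/qclassW=> z; rewrite !qmulE.
by apply: qlocal_ext => n /=; rewrite mulmxA.
Qed.

Lemma qmul1l : left_id qone qmul.
Proof.
by elim/qclassW=> x; rewrite qmulE; apply: qlocal_ext => n /=; rewrite mul1mx.
Qed.

Lemma qmul1r : right_id qone qmul.
Proof.
by elim/qclassW=> x; rewrite qmulE; apply: qlocal_ext => n /=; rewrite mulmx1.
Qed.

Lemma qmulDl : left_distributive qmul qadd.
Proof.
elim/qclassW=> x; elim/qclassW=> y; elim/qclassW=> z; rewrite !(qmulE, qaddE).
by apply: qlocal_ext => n /=; rewrite mulmxDl.
Qed.

Lemma qmulDr : right_distributive qmul qadd.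
Proof.
elim/qclassW=> x; elim/qclassW=> y; elim/qclassW=> z; rewrite !(qmulE, qaddE).
by apply: qlocal_ext => n /=; rewrite mulmxDr.
Qed.

HB.instance Definition _ :=
  GRing.Zmodule_isPzRing.Build qlocal qmulA qmul1l qmul1r qmulDl qmulDr.

Lemma qscaleA a b u : qscale a (qscale b u) = qscale (a * b) u.
Proof.
elim/qclassW: u => x; rewrite !qscaleE.
by apply: qlocal_ext => n /=; rewrite scalerA.
Qed.

Lemma qscale1 : left_id 1 qscale.
Proof.
by elim/qclassW=> x; rewrite qscaleE; apply: qlocal_ext => n /=; rewrite scale1r.
Qed.

Lemma qscaleDr : right_distributive qscale +%R.
Proof.
move=> a; elim/qclassW=> x; elim/qclassW=> y; rewrite -[LHS]/(qscale _ (qadd _ _)).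
rewrite -[RHS]/(qadd _ _) !(qaddE, qscaleE).
by apply: qlocal_ext => n /=; rewrite scalerDr.
Qed.

Lemma qscaleDl u : {morph qscale^~ u : a b / a + b}.
Proof.
elim/qclassW: u => x a b; rewrite -[RHS]/(qadd _ _) !(qscaleE, qaddE).
by apply: qlocal_ext => n /=; rewrite scalerDl.
Qed.

HB.instance Definition _ :=
  GRing.Zmodule_isLmodule.Build C qlocal qscaleA qscale1 qscaleDr qscaleDl.

(* X (x) 1 in B_[1,n], with the dummy value 0 for n < N. *)
Definition local_seq N (X : loc R d N) : locseq := fun n =>
  if @idP (N <= n)%N is ReflectT h then emb h X else 0.

Lemma local_seqE N n (h : (N <= n)%N) (X : loc R d N) :
  local_seq X n = emb h X.
Proof.
rewrite /local_seq; case: {-}_ / idP => // h'.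
by rewrite (bool_irrelevance h' h).
Qed.

Lemma local_seq_cauchy N (X : loc R d N) : cauchy_loc (local_seq X).
Proof.
move=> e e0; exists N => m n h Nm.
by rewrite (local_seqE (leq_trans Nm h)) (local_seqE Nm) (emb_comp Nm h (leq_trans Nm h)) subrr opnorm0.
Qed.

(* The inclusion of B_[1,N] in B_N. *)
Definition local_emb N (X : loc R d N) : qlocal := qclass (Cseq (local_seq_cauchy X)).

Lemma local_emb_eq N M (X : loc R d N) (y : cseq) :
  (forall n, (M <= n)%N -> local_seq X n = val y n) -> local_emb X = qclass y.
Proof.
move=> h; apply: qlocalP => e e0; exists M => n Mn.
by rewrite /= h // subrr opnorm0.
Qed.

Lemma local_emb_comp N n (h : (N <= n)%N) (X : loc R d N) :
  local_emb (emb h X) = local_emb X.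
Proof.
apply: (@local_emb_eq _ n) => m nm /=.
by rewrite (local_seqE nm) (local_seqE (leq_trans h nm)) (emb_comp _ _ (leq_trans h nm)).
Qed.

Lemma local_emb_is_linear N : linear (@local_emb N).
Proof.
move=> a X Y; rewrite -[RHS]/(qadd (qscale _ _) _) qscaleE qaddE.
by apply: (@local_emb_eq _ N) => n h /=; rewrite !(local_seqE h) linearP.
Qed.

HB.instance Definition _ N := GRing.isLinear.Build C (loc R d N) qlocal _
  (@local_emb N) (@local_emb_is_linear N).

Lemma local_embM N (X Y : loc R d N) :
  local_emb (X *m Y) = local_emb X * local_emb Y.
Proof.
rewrite -[RHS]/(qmul _ _) qmulE.
by apply: (@local_emb_eq _ N) => n h /=; rewrite !(local_seqE h) embM.
Qed.

Lemma local_emb1 N : local_emb (1%:M : loc R d N) = 1.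
Proof. by apply: (@local_emb_eq _ N) => n h /=; rewrite local_seqE emb1. Qed.

Lemma local_emb_star N (X : loc R d N) :
  local_emb (X^t* ) = qstar (local_emb X).
Proof.
rewrite qstarE.
by apply: (@local_emb_eq _ N) => n h /=; rewrite !(local_seqE h) emb_adj.
Qed.

(* In R[i], 0 <= z means that z is real and nonnegative. *)
Definition is_state (phi : qlocal -> C) : Prop :=
  [/\ scalar phi, (forall x, 0 <= phi (qstar x * x)) & phi 1 = 1].

End InfiniteTensorProduct.

Section Loewner.
Variables (R : realType) (D : nat).
Notation C := R[i].

Definition psdmx (M : 'M[C]_D) : Prop :=
  M \is hermsymmx /\ forall v : 'cV[C]_D, 0 <= (v^t* *m M *m v) 0 0.

Definition loewner_le (B M : 'M[C]_D) : Prop := psdmx (M - B).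

(* K is the greatest lower bound of S for the Loewner order (which need not
   exist, as this order is not a lattice). *)
Definition is_loewner_inf (S : set 'M[C]_D) (K : 'M[C]_D) : Prop :=
  (forall M, S M -> loewner_le K M) /\
  (forall B, (forall M, S M -> loewner_le B M) -> loewner_le B K).

Definition is_markov_dobrushin (Phi : 'M[C]_D -> 'M[C]_D) (K : 'M[C]_D) : Prop :=
  is_loewner_inf [set Phi (xi *m xi^t* ) | xi in [set xi : 'cV[C]_D | l2norm xi = 1]] K.

Definition is_density (rho : 'M[C]_D) : Prop := psdmx rho /\ \tr rho = 1.

End Loewner.

Section MatrixProducts.
Variables (R : realType) (d D : nat) (A : 'I_d -> 'M[R[i]]_D).
Notation C := R[i].

Definition mps n : 'cV[C]_#|{: conf d n}| :=
  \col_a \tr (\prod_(k < n) A ((enum_val a : conf d n) k)).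

Definition mps_norm2 n : C := ((mps n)^t* *m mps n) 0 0.

(* The state phi_n; it is defined with the vector Psi_{n+1}. *)
Definition mps_state n (X : loc R d n) : C :=
  ((mps n.+1)^t* *m emb (leqnSn n) X *m mps n.+1) 0 0 / mps_norm2 n.+1.

Definition channel (M : 'M[C]_D) : 'M[C]_D :=
  \sum_(i < d) (A i)^t* *m M *m A i.

(* The reversed index gives A_{i_N}^* ... A_{i_1}^* on the left of M. *)
Definition hat N (X : loc R d N) (M : 'M[C]_D) : 'M[C]_D :=
  \sum_(s : conf d N) \sum_(t : conf d N)
    braket s X t *:
      ((\prod_(k < N) (A (s (rev_ord k)))^t* ) *m M *m \prod_(k < N) A (t k)).

Definition basis_vec (al : 'I_D) : 'cV[C]_D := delta_mx al 0.

Definition limit_value (rho : 'M[C]_D) N (X : loc R d N) : C :=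
  \sum_(al < D) \sum_(be < D)
    ((basis_vec al)^t* *m rho *m basis_vec be) 0 0
      * \tr (hat X (basis_vec al *m (basis_vec be)^t* )).

End MatrixProducts.

(* Main.v *)
(* The Markov-Dobrushin bound says that Psi(M) = Phi(M) - tr(M) kappa is a
   positive map; it multiplies traces by 1 - tr(kappa) < 1, and a positive matrix
   has entries bounded by its trace, so Psi^n tends to 0 geometrically.  Hence
   1 - Psi is invertible, (1 - Psi) rho = kappa gives the invariant state, and
   Phi^n(M) -> tr(M) rho because Phi and Psi agree on traceless matrices.

   Expanding both traces in <Psi_m| X (x) 1 |Psi_m> over the standard basis gives
   sum_{a,b} (Phi^(m-N)(hat X(E_ab)))_ab, whose limit is the stated formula.  The
   limit functional inherits positivity and the bound by the operator norm from
   the vector states, so it extends to the completion.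

   A state is determined by its values on local elements because positive
   functionals are continuous: if a is self-adjoint and small then 1 - a = u^* u,
   hence psi(a) <= 1. *)

Require Import Defs.
From HB Require Import structures.
From mathcomp Require Import all_boot all_order all_algebra.
From mathcomp Require Import all_classical all_reals all_analysis.
From mathcomp Require Import complex.
From mathcomp Require Import ring lra zify.
Import Order.TTheory GRing.Theory Num.Theory.
Import numFieldNormedType.Exports.
Local Open Scope classical_set_scope.
Local Open Scope ring_scope.
Local Open Scope sesquilinear_scope.

Set Implicit Arguments.
Unset Strict Implicit.
Unset Printing Implicit Defensive.

(** * Limits of complex sequences *)

Section ComplexLimits.
Variable R : realType.
Notation C := R[i].

Lemma cvgC_unique (f : nat -> C) (a b : C) :
  (fun n => f n : C^o) @ \oo --> (a : C^o) ->
  (fun n => f n : C^o) @ \oo --> (b : C^o) -> a = b.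
Proof. exact: (cvg_unique (@norm_hausdorff _ C^o)). Qed.

Lemma cvgC_eventually (f g : nat -> C) (M : nat) (a : C) :
  (forall n, (M <= n)%N -> f n = g n) ->
  (fun n => f n : C^o) @ \oo --> (a : C^o) ->
  (fun n => g n : C^o) @ \oo --> (a : C^o).
Proof.
move=> fg; apply: cvg_trans; apply: near_eq_cvg.
by exists M => // n /= Mn; rewrite fg.
Qed.

Lemma ltr0c (x : R) : (0 < x%:C%C) = (0 < x).
Proof. exact: ltcR. Qed.

Lemma gtC0_real (e : C) : 0 < e -> exists2 r : R, 0 < r & e = r%:C%C.
Proof.
move=> e0; exists (complex.Re e); last by rewrite RRe_real ?gtr0_real.
by rewrite -ltr0c RRe_real ?gtr0_real.
Qed.

Lemma cvgCP (f : nat -> C) (a : C) :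
  (fun n => f n : C^o) @ \oo --> (a : C^o) <->
  forall e : R, 0 < e -> exists M, forall n, (M <= n)%N -> `|f n - a| <= e%:C%C.
Proof.
split=> [fa e e0|fa].
  have /cvgrPdist_le /(_ e%:C%C) := fa; rewrite ltr0c => /(_ e0)[M _ HM].
  by exists M => n Mn; rewrite distrC; apply: HM.
apply/cvgrPdist_le => e /gtC0_real[r r0 ->].
have [M HM] := fa r r0; exists M => // n /= Mn.
by rewrite distrC; apply: HM.
Qed.

(** Taking norms does not increase distances, so the sequence also tends to the norm of [a]; by
    uniqueness of limits [a] equals its norm. *)
Lemma cvgC_ge0 (f : nat -> C) (M : nat) (a : C) :
  (forall n, (M <= n)%N -> 0 <= f n) ->
  (fun n => f n : C^o) @ \oo --> (a : C^o) -> 0 <= a.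
Proof.
move=> f0 fa; suff -> : a = `|a| by [].
apply: (cvgC_unique fa); apply/cvgCP => e e0.
have /cvgCP/(_ e e0)[N HN] := fa; exists (maxn M N) => n.
rewrite geq_max => /andP[Mn Nn]; rewrite -{1}(ger0_norm (f0 n Mn)).
exact: le_trans (ler_dist_dist _ _) (HN n Nn).
Qed.

Lemma geometric_small (r c e : R) : 0 <= r -> r < 1 -> 0 < e ->
  exists M, forall n, (M <= n)%N -> c * r ^+ n <= e.
Proof.
move=> r0 r1 e0.
have /cvgrPdist_le /(_ e e0)[M _ HM] : (fun n => c * r ^+ n) @ \oo --> 0.
  by apply: cvg_geometric; rewrite ger0_norm.
exists M => n /HM; rewrite sub0r normrN; exact: le_trans (ler_norm _).
Qed.

Lemma cvgC_geometric (f : nat -> C) (a : C) (r c : R) : 0 <= r -> r < 1 ->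
  (forall n, `|f n - a| <= (c * r ^+ n)%:C%C) ->
  (fun n => f n : C^o) @ \oo --> (a : C^o).
Proof.
move=> r0 r1 H; apply/cvgCP => e e0.
have [M HM] := geometric_small c r0 r1 e0.
by exists M => n Mn; apply: le_trans (H n) _; rewrite lecR HM.
Qed.

Lemma cvgC_sum (I : finType) (f : I -> nat -> C) (a : I -> C) :
  (forall i, (fun n => f i n : C^o) @ \oo --> (a i : C^o)) ->
  (fun n => \sum_i f i n : C^o) @ \oo --> (\sum_i a i : C^o).
Proof.
move=> H; apply: (@cvg_big C^o I +%R 0 xpredT); last by move=> i _; exact: H.
exact: add_continuous.
Qed.

End ComplexLimits.

(** * Spectral decomposition and the span of the rank-one matrices *)

Section ComplexMatrices.
Variables (C : numClosedFieldType) (D : nat).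

Lemma adjmxD m n (X Y : 'M[C]_(m, n)) : (X + Y)^t* = X^t* + Y^t*.
Proof. by rewrite linearD /= map_mxD. Qed.

Lemma adjmxB m n (X Y : 'M[C]_(m, n)) : (X - Y)^t* = X^t* - Y^t*.
Proof. by rewrite linearB /= map_mxB. Qed.

Lemma adjmxZ m n a (X : 'M[C]_(m, n)) : (a *: X)^t* = a^* *: X^t*.
Proof. by rewrite linearZ /= map_mxZ. Qed.

Lemma adjmxM m n p (X : 'M[C]_(m, n)) (Y : 'M[C]_(n, p)) :
  (X *m Y)^t* = Y^t* *m X^t*.
Proof. by rewrite trmx_mul map_mxM. Qed.

Lemma adjmxK m n (X : 'M[C]_(m, n)) : (X^t*)^t* = X.
Proof. exact: trmxCK. Qed.

(** The vectors are the adjoints of the rows of the unitary [spectralmx M]. Writing each eigenvalue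
    as a quadratic form of [M] lets positivity pass to it at once. *)
Lemma normalmx_spectral (M : 'M[C]_D) : M \is normalmx ->
  exists (a : 'I_D -> C) (v : 'I_D -> 'cV[C]_D),
    [/\ forall k, a k = ((v k)^t* *m M *m v k) 0 0, forall k, (v k)^t* *m v k = 1%:M
      & M = \sum_k a k *: (v k *m (v k)^t* )].
Proof.
move=> /orthomx_spectralP.
have uP := spectral_unitarymx M; rewrite invmx_unitary //.
set P := spectralmx M in uP *; set s := spectral_diag M => ME.
pose v k : 'cV[C]_D := (row k P)^t*.
have PP : P *m P^t* = 1%:M by apply/eqP: uP.
have vv k : (v k)^t* *m v k = 1%:M.
  rewrite adjmxK; apply/matrixP => i j; rewrite !ord1 /v.
  have /row_unitarymxP/(_ k k) := uP.
  by rewrite dotmxE eqxx => ->; rewrite mxE.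
have vE k : (v k)^t* = delta_mx 0 k *m P by rewrite adjmxK rowE.
exists (fun k => s 0 k), v; split=> [k|k|].
- apply/esym; rewrite {1}ME vE -{1}[v k]adjmxK vE adjmxM.
  rewrite -!mulmxA (mulmxA P (P^t*)) PP mul1mx (mulmxA P (P^t*)) PP mul1mx.
  rewrite !mulmxA -rowE mxE (bigD1 k) //= big1 => [|j jk]; last first.
    by rewrite !mxE (negPf jk) andbF /= conjC0 mulr0.
  by rewrite !mxE !eqxx mulr1n /= conjC1 mulr1 addr0.
- exact: vv.
rewrite {1}ME mul_mx_diag; apply/matrixP => i j.
rewrite mxE summxE; apply: eq_bigr => k _.
by rewrite /v adjmxK !mxE big_ord1 !mxE mulrAC [RHS]mulrC.
Qed.

(** Cartesian decomposition: for [w] the imaginary unit, [w *: (M^t* - M)] and [M + M^t*] are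
    self-adjoint. *)
Lemma adjmx_decomposition (w : C) (M : 'M[C]_D) : w * w = -1 ->
  M = (2^-1 : C) *: (w *: (w *: (M^t* - M)) + (M + M^t* )).
Proof.
move=> ww; rewrite scalerA ww scaleN1r opprB (addrC M (M^t* )) addrA subrK.
rewrite -[X in _ *: (X + _)]scale1r -[X in _ *: (_ + X)]scale1r -scalerDl.
by rewrite scalerA mulVf ?scale1r // pnatr_eq0.
Qed.

(** The spectral theorem covers the Hermitian matrices and the Cartesian decomposition all others.
    Estimates stable under linear combinations thus reduce to positive rank-one matrices. *)
Lemma outer_span (P : 'M[C]_D -> Prop) :
  (forall (a : C) X Y, P X -> P Y -> P (a *: X + Y)) ->
  (forall v : 'cV[C]_D, P (v *m v^t* )) -> forall M, P M.
Proof.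
move=> Plin Pv; have P0 : P 0 by have := Pv 0; rewrite mul0mx.
have PZ a X : P X -> P (a *: X) by move=> PX; rewrite -[_ *: _]addr0; apply: Plin.
have PD X Y : P X -> P Y -> P (X + Y).
  by move=> PX PY; rewrite -[X]scale1r; apply: Plin.
have Pherm X : X^t* = X -> P X.
  move=> hX; have [|a [v [_ _ ->]]] := @normalmx_spectral X.
    by apply/normalmxP; rewrite hX.
  by apply: (big_ind P P0 PD) => k _; apply: PZ.
move=> M.
have [w ww wc] : exists2 w : C, w * w = -1 & w^* = - w.
  by exists 'i; rewrite ?conjCi // -expr2 sqrCi.
rewrite (adjmx_decomposition M ww).
apply: (PZ); apply: PD; last by apply: Pherm; rewrite adjmxD adjmxK addrC.
by apply: PZ; apply: Pherm; rewrite adjmxZ adjmxB adjmxK wc scaleNr -scalerN opprB.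
Qed.

End ComplexMatrices.

(** * Positive semidefinite matrices, their traces and limits *)

Section PositiveMatrices.
Variables (R : realType) (D : nat).
Notation C := R[i].
Implicit Types (M : 'M[C]_D) (v : 'cV[C]_D).

Lemma psdmx_adj M : psdmx M -> M^t* = M.
Proof. by case=> /is_hermitianmxP; rewrite expr0 scale1r => <-. Qed.

Lemma psdmxP M : M^t* = M -> (forall v, 0 <= (v^t* *m M *m v) 0 0) -> psdmx M.
Proof. by move=> h p; split=> //; apply/is_hermitianmxP; rewrite expr0 scale1r h. Qed.

Lemma psdmxD M1 M2 : psdmx M1 -> psdmx M2 -> psdmx (M1 + M2).
Proof.
move=> p1 p2; apply: psdmxP => [|v]; first by rewrite adjmxD !psdmx_adj.
by rewrite mulmxDr mulmxDl mxE addr_ge0 ?p1.2 ?p2.2.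
Qed.

Lemma psdmxZ a M : 0 <= a -> psdmx M -> psdmx (a *: M).
Proof.
move=> a0 p; apply: psdmxP => [|v].
  by rewrite adjmxZ psdmx_adj // geC0_conj.
by rewrite -scalemxAr -scalemxAl mxE mulr_ge0 ?p.2.
Qed.

Lemma psdmx0 : psdmx (0 : 'M[C]_D).
Proof.
apply: psdmxP => [|v]; first by rewrite trmx0 map_mx0.
by rewrite mulmx0 mul0mx mxE.
Qed.

Lemma psdmx_sum (I : finType) (F : I -> 'M[C]_D) :
  (forall i, psdmx (F i)) -> psdmx (\sum_i F i).
Proof.
by move=> H; apply: (big_ind (@psdmx R D)) => [||i _]; [exact: psdmx0|exact: psdmxD|].
Qed.

Lemma l2norm_dot v : (v^t* *m v) 0 0 = (l2norm v ^+ 2)%:C%C.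
Proof. by rewrite rcX l2normE sqrtCK dotE. Qed.

Lemma psdmx_outer v : psdmx (v *m v^t* ).
Proof.
apply: psdmxP => [|w]; first by rewrite adjmxM adjmxK.
rewrite (_ : _ *m w = (w^t* *m v) *m (w^t* *m v)^t* ); last first.
  by rewrite adjmxM adjmxK !mulmxA.
by rewrite mxE big_ord1 2![in X in _ * X]mxE mul_conjC_ge0.
Qed.

Lemma trace_outer v : \tr (v *m v^t* ) = (l2norm v ^+ 2)%:C%C.
Proof. by rewrite mxtrace_mulC trace_mx11 l2norm_dot. Qed.

Lemma psdmx_spectral M : psdmx M ->
  exists (a : 'I_D -> C) (v : 'I_D -> 'cV[C]_D),
    [/\ forall k, 0 <= a k, forall k, l2norm (v k) = 1
      & M = \sum_k a k *: (v k *m (v k)^t* )].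
Proof.
move=> [hM pM]; have [a [v [aE v1 ME]]] := normalmx_spectral (hermitian_normalmx hM).
exists a, v; split=> // k; first by rewrite aE.
apply/eqP; rewrite -(@eqrXn2 _ 2) ?l2norm_ge0 // expr1n.
by rewrite -(inj_eq (@complexI R)) -l2norm_dot v1 mxE eqxx.
Qed.

Lemma outer_entry v i j : (v *m v^t* ) i j = v i 0 * (v j 0)^*.
Proof. by rewrite mxE big_ord1 !mxE. Qed.

(** In the spectral decomposition each [v k *m (v k)^t*] has trace 1 and entries of modulus at most
    1, and the weights are nonnegative. *)
Lemma psdmx_entry_le_trace M i j : psdmx M -> `|M i j| <= \tr M.
Proof.
move=> /psdmx_spectral[a [v [a0 v1 ->]]]; rewrite summxE raddf_sum /=.
apply: le_trans (ler_norm_sum _ _ _) _; apply: ler_sum => k _.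
rewrite linearZ /= trace_outer v1 mxE outer_entry !normrM norm_conjC.
rewrite (ger0_norm (a0 k)) ler_wpM2l // expr1n.
rewrite -normCE -(normCE (v k j 0)) -rcM lecR -[leRHS]mulr1.
by rewrite ler_pM ?normC_ge0 // -(v1 k) l2norm_coord.
Qed.

Lemma psdmx_trace_ge0 M : psdmx M -> 0 <= \tr M.
Proof.
move=> /psdmx_spectral[a [v [a0 v1 ->]]]; rewrite raddf_sum /= sumr_ge0 // => k _.
by rewrite linearZ /= trace_outer v1 expr1n mulr1.
Qed.

Lemma psdmx_trace_eq0 M : psdmx M -> \tr M = 0 -> M = 0.
Proof.
move=> pM t0; apply/matrixP => i j; rewrite mxE; apply/eqP.
by rewrite -normr_le0 -t0 psdmx_entry_le_trace.
Qed.

Lemma psdmx_lim (f : nat -> 'M[C]_D) M : (forall n, psdmx (f n)) ->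
  (forall i j, (fun n => f n i j : C^o) @ \oo --> (M i j : C^o)) -> psdmx M.
Proof.
move=> pf fM; apply: psdmxP => [|v].
  apply/matrixP => i j; apply: (@cvgC_unique _ (fun n => f n i j)) (fM i j).
  apply/cvgCP => e e0; have /cvgCP/(_ e e0)[N HN] := fM j i.
  exists N => n Nn; rewrite -(psdmx_adj (pf n)) !mxE -rmorphB norm_conjC.
  exact: HN.
apply: (@cvgC_ge0 _ (fun n => (v^t* *m f n *m v) 0 0) 0) => [n _|]; first exact: (pf n).2.
have E (X : 'M[C]_D) : (v^t* *m X *m v) 0 0 = \sum_i \sum_j (v j 0)^* * v i 0 * X j i.
  rewrite mxE; apply: eq_bigr => i _; rewrite mxE mulr_suml; apply: eq_bigr => j _.
  by rewrite !mxE mulrAC.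
under eq_cvg do rewrite E.
rewrite E; apply: cvgC_sum => i; apply: cvgC_sum => j.
by apply: cvgM => //; apply: cvg_cst.
Qed.

End PositiveMatrices.

(** * Completeness of the complex numbers, through real and imaginary parts *)

Section ComplexCompleteness.
Variable R : realType.
Notation C := R[i].

Lemma cauchyR_cvg (u : nat -> R) :
  (forall e : R, 0 < e -> exists M, forall n, (M <= n)%N -> `|u M - u n| <= e) ->
  cvg (u @ \oo).
Proof.
move=> H; apply: cauchy_cvg; apply/cauchyP => e e0.
have [M HM] := H (e / 2) (divr_gt0 e0 (ltr0n _ 2)).
exists (u M); exists M => // n /= /HM Hn; rewrite /ball /=.
by apply: le_lt_trans Hn _; rewrite ltr_pdivrMr // ltr_pMr // ltr1n.
Qed.

Lemma normC_real (x : R) : `|x%:C%C : C| = (`|x|)%:C%C.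
Proof. by rewrite normc_def /= expr0n addr0 sqrtr_sqr. Qed.

Lemma normC_le_ReIm (z : C) :
  `|z| <= (`|complex.Re z| + `|complex.Im z|)%:C%C.
Proof.
rewrite {1}[z]complexE rmorphD /= -!normC_real; apply: (le_trans (ler_normD _ _)).
by rewrite lerD2l normrM complexiE normCi mul1r.
Qed.

(** Multiplication by the imaginary unit keeps the norm and turns the imaginary part, up to sign,
    into the real part. *)
Lemma normC_ge_Im (z : C) : (`|complex.Im z|)%:C%C <= `|z|.
Proof.
have := normc_ge_Re (z * 'i%C); rewrite ReiNIm normrN normrM.
by rewrite complexiE normCi mulr1.
Qed.

Lemma cauchyC_cvg (f : nat -> C) :
  (forall e : R, 0 < e -> exists M, forall m n, (M <= m)%N -> (m <= n)%N ->
    `|f n - f m| <= e%:C%C) ->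
  exists a : C, (fun n => f n : C^o) @ \oo --> (a : C^o).
Proof.
move=> H.
have cRe : cvg ((fun n => complex.Re (f n)) @ \oo).
  apply: cauchyR_cvg => e e0; have [M HM] := H e e0; exists M => n Mn.
  rewrite -lecR distrC -raddfB; apply: le_trans (HM M n (leqnn M) Mn).
  exact: normc_ge_Re.
have cIm : cvg ((fun n => complex.Im (f n)) @ \oo).
  apply: cauchyR_cvg => e e0; have [M HM] := H e e0; exists M => n Mn.
  rewrite -lecR distrC -raddfB; apply: le_trans (HM M n (leqnn M) Mn).
  exact: normC_ge_Im.
exists (lim ((fun n => complex.Re (f n)) @ \oo)
  +i* lim ((fun n => complex.Im (f n)) @ \oo))%C.
apply/cvgCP => e e0.
have /cvgrPdist_le/(_ _ (half_pos e0))[M1 _ HM1] := cRe.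
have /cvgrPdist_le/(_ _ (half_pos e0))[M2 _ HM2] := cIm.
exists (maxn M1 M2) => n; rewrite geq_max => /andP[h1 h2].
apply: (le_trans (normC_le_ReIm _)); rewrite lecR (splitr e).
apply: lerD; first by have := HM1 n h1; rewrite distrC; case: (f n).
by have := HM2 n h2; rewrite distrC; case: (f n).
Qed.

End ComplexCompleteness.

(** * Contraction and invariant state under the Markov-Dobrushin condition *)

Section PrimitiveChannel.
Variables (R : realType) (d D : nat) (A : 'I_d -> 'M[R[i]]_D).
Notation C := R[i].
Implicit Types M X Y : 'M[C]_D.

Lemma channel_is_linear : linear (channel A).
Proof.
move=> a X Y; rewrite /channel scaler_sumr -big_split /=; apply: eq_bigr => i _.
by rewrite mulmxDr mulmxDl -scalemxAr -scalemxAl.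
Qed.

HB.instance Definition _ :=
  GRing.isLinear.Build C 'M[C]_D 'M[C]_D _ (channel A) channel_is_linear.

Section Trace.
Hypothesis hA : \sum_(i < d) A i *m (A i)^t* = 1%:M.

Lemma trace_channel M : \tr (channel A M) = \tr M.
Proof.
rewrite /channel raddf_sum /=.
under eq_bigr do rewrite -mulmxA mxtrace_mulC -mulmxA.
by rewrite -(raddf_sum (@mxtrace C D)) -mulmx_sumr /= hA mulmx1.
Qed.

Variable kappa : 'M[C]_D.
Hypotheses (hkappa : is_markov_dobrushin (channel A) kappa)
  (kappa_ge0 : psdmx kappa) (kappa_neq0 : kappa != 0).

(** This is the map Psi of the opening explanation. *)
Definition defect M := channel A M - \tr M *: kappa.

Lemma defect_is_linear : linear defect.
Proof.
move=> a X Y; rewrite /defect !linearP /= scalerDl -scalerA scalerBr.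
by rewrite opprD addrACA.
Qed.

HB.instance Definition _ :=
  GRing.isLinear.Build C 'M[C]_D 'M[C]_D _ defect defect_is_linear.

(** For a unit vector [v] the claim on [v *m v^t*] is that [kappa] is a lower bound; the spectral
    decomposition extends it. *)
Lemma psdmx_defect M : psdmx M -> psdmx (defect M).
Proof.
move=> /psdmx_spectral[a [v [a0 v1 ->]]]; rewrite linear_sum; apply: psdmx_sum => k.
rewrite linearZ /=; apply: psdmxZ; first exact: a0.
rewrite /defect trace_outer v1 expr1n scale1r.
by apply: hkappa.1; exists (v k).
Qed.

Lemma trace_defect M : \tr (defect M) = (1 - \tr kappa) * \tr M.
Proof. by rewrite /defect linearB linearZ /= trace_channel mulrBl mul1r mulrC. Qed.

Lemma trace_kappa_gt0 : 0 < \tr kappa.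
Proof.
rewrite lt_def psdmx_trace_ge0 // andbT; apply: contra kappa_neq0 => /eqP t0.
exact/eqP/psdmx_trace_eq0.
Qed.

Lemma trace_kappa_le1 : \tr kappa <= 1.
Proof.
have [a [v [_ v1 kE]]] := psdmx_spectral kappa_ge0.
(* A unit vector is available because for [D = 0] the spectral sum is empty and [kappa] would
   vanish. Its rank-one matrix has a positive defect, of trace [1 - \tr kappa]. *)
have k : 'I_D.
  case: (pickP 'I_D) => [k _ //|D0]; case/negP: kappa_neq0.
  by apply/eqP; rewrite kE big_pred0.
have := psdmx_trace_ge0 (psdmx_defect (psdmx_outer (v k))).
by rewrite trace_defect trace_outer v1 expr1n mulr1 subr_ge0.
Qed.

Definition rate : R := complex.Re (1 - \tr kappa).

Lemma rateE : rate%:C%C = 1 - \tr kappa.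
Proof. by rewrite RRe_real // ger0_real // subr_ge0 trace_kappa_le1. Qed.

Lemma rate_ge0 : 0 <= rate.
Proof. by rewrite -ler0c rateE subr_ge0 trace_kappa_le1. Qed.

Lemma rate_lt1 : rate < 1.
Proof. by rewrite -ltcR rateE ltrBlDr ltrDl trace_kappa_gt0. Qed.

Lemma iter_linear (f : {linear 'M[C]_D -> 'M[C]_D}) n : linear (iter n f).
Proof. by move=> a X Y; elim: n => //= n ->; rewrite linearP. Qed.

(** For positive [M] the iterates stay positive, and their trace, which bounds the entries, is
    multiplied by [rate] at each step. [outer_span] reaches all [M], with a constant depending on
    [M]. *)
Lemma iter_defect_bound M : exists c : R, forall n i j,
  `|iter n defect M i j| <= (c * rate ^+ n)%:C%C.
Proof.
move: M; apply: outer_span => [a X Y [c1 H1] [c2 H2]|v].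
  exists (complex.Re `|a| * c1 + c2) => n i j.
  rewrite iter_linear !mxE (le_trans (ler_normD _ _)) // mulrDl rmorphD /=.
  rewrite lerD // normrM -mulrA rcM normCE ler_wpM2l //.
have pv := psdmx_outer v; move: (v *m v^t* ) pv => M pM.
have tr0 := psdmx_trace_ge0 pM.
exists (complex.Re (\tr M)) => n i j.
have [pn tn] : psdmx (iter n defect M) /\
    \tr (iter n defect M) = (complex.Re (\tr M) * rate ^+ n)%:C%C.
  elim: n => [|n [pn tn]] /=; first by rewrite expr0 mulr1 RRe_real ?ger0_real.
  split; first exact: psdmx_defect.
  by rewrite trace_defect tn -rateE -rcM exprS mulrCA.
by rewrite -tn psdmx_entry_le_trace.
Qed.

(** The orbit of a fixed point is constant, yet tends to 0. *)
Lemma defect_fixed M : defect M = M -> M = 0.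
Proof.
move=> fM; have [c H] := iter_defect_bound M; apply/matrixP => i j; rewrite mxE.
apply: (@cvgC_unique _ (fun=> M i j)); first exact: cvg_cst.
apply: (@cvgC_geometric _ _ _ rate c rate_ge0 rate_lt1) => n.
have <- : iter n defect M = M by elim: n => //= n ->.
by rewrite subr0.
Qed.

Lemma iter_channel_traceless n M : \tr M = 0 -> iter n (channel A) M = iter n defect M.
Proof.
move=> t0; elim: n => //= n ->; rewrite /defect.
suff -> : \tr (iter n defect M) = 0 by rewrite scale0r subr0.
by elim: n => //= n tn; rewrite trace_defect tn mulr0.
Qed.

Lemma channel_fixed_traceless M : \tr M = 0 -> channel A M = M -> M = 0.
Proof. by move=> t0 fM; apply: defect_fixed; rewrite /defect t0 scale0r subr0. Qed.

Definition codefect M := M - defect M.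

Lemma codefect_is_linear : linear codefect.
Proof. by move=> a X Y; rewrite /codefect linearP opprD addrACA scalerBr. Qed.

HB.instance Definition _ :=
  GRing.isLinear.Build C 'M[C]_D 'M[C]_D _ codefect codefect_is_linear.

(* The fixed points of trace one are the solutions of (1 - defect) rho = kappa,
   and 1 - defect is injective, hence onto. *)
Lemma channel_fixed_exists : exists2 rho, \tr rho = 1 & channel A rho = rho.
Proof.
pose f : 'End('M[C]_D) := linfun codefect.
have f0 : lker f == 0%VS.
  apply/lker0P => X Y; rewrite !lfunE /= => XY.
  apply/eqP; rewrite -subr_eq0; apply/eqP; apply: defect_fixed.
  have /eqP : codefect (X - Y) = 0 by rewrite linearB /= XY subrr.
  by rewrite /codefect subr_eq0 => /eqP.
pose rho := (f^-1)%VF kappa.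
have rhoE : rho - defect rho = kappa.
  by have := lker0_lfunVK f0 kappa; rewrite lfunE.
(* Taking traces in [rhoE] gives [\tr kappa * \tr rho = \tr kappa], and [\tr kappa] is nonzero. *)
have tr1 : \tr rho = 1.
  have := congr1 mxtrace rhoE; rewrite linearB /= trace_defect.
  rewrite mulrBl mul1r opprB addrC subrK -[RHS]mulr1.
  by apply: mulfI; rewrite gt_eqF // trace_kappa_gt0.
exists rho => //; apply/eqP; rewrite -subr_eq0 -oppr_eq0 opprB; apply/eqP.
apply: (addIr kappa); rewrite add0r -[RHS]rhoE /defect tr1 scale1r.
by rewrite opprB addrA addrAC.
Qed.

(** Split [M] into [\tr M *: rho], which is fixed, and a traceless [X], on which the channel
    iterates like [defect] and decays geometrically. *)
Lemma iter_channel_cvg rho M : \tr rho = 1 -> channel A rho = rho ->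
  forall i j, (fun n => iter n (channel A) M i j : C^o) @ \oo -->
    (\tr M * rho i j : C^o).
Proof.
move=> tr1 frho i j; pose X := M - \tr M *: rho.
have X0 : \tr X = 0 by rewrite linearB linearZ /= tr1 mulr1 subrr.
have [c H] := iter_defect_bound X.
apply: (@cvgC_geometric _ _ _ rate c rate_ge0 rate_lt1) => n.
have rn : iter n (channel A) rho = rho by elim: n => //= n ->.
have -> : iter n (channel A) M = iter n (channel A) X + \tr M *: rho.
  have := iter_linear (channel A) n (\tr M) rho X; rewrite rn [RHS]addrC => <-.
  by congr iter; rewrite [RHS]addrC subrK.
by rewrite !mxE addrK iter_channel_traceless.
Qed.

(** Inverting 1 - Psi says nothing about positivity. That comes from [rho] being the limit of the
    iterates of a density matrix, here [kappa] divided by its trace. *)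
Lemma channel_density_exists : exists2 rho, is_density rho & channel A rho = rho.
Proof.
have [rho tr1 frho] := channel_fixed_exists.
exists rho; last exact: frho.
split; last exact: tr1.
pose s := (\tr kappa)^-1 *: kappa.
have s1 : \tr s = 1 by rewrite linearZ /= mulVf // gt_eqF // trace_kappa_gt0.
have ps : psdmx s by apply: psdmxZ => //; rewrite invr_ge0 ltW // trace_kappa_gt0.
apply: (@psdmx_lim _ _ (fun n => iter n (channel A) s)) => [n|i j].
  elim: n => [|n pn]; first exact: ps.
  (* The channel is [defect] plus the trace times [kappa], and both summands preserve positivity. *)
  rewrite iterS -[channel A _](subrK (\tr (iter n (channel A) s) *: kappa)).
  apply: psdmxD; first exact: psdmx_defect.
  by apply: psdmxZ kappa_ge0; apply: psdmx_trace_ge0.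
by have := @iter_channel_cvg rho s tr1 frho i j; rewrite s1 mul1r.
Qed.

Lemma channel_density_unique rho sigma : is_density rho -> channel A rho = rho ->
  is_density sigma -> channel A sigma = sigma -> sigma = rho.
Proof.
move=> [_ r1] fr [_ s1] fs; apply/eqP; rewrite -subr_eq0; apply/eqP.
apply: channel_fixed_traceless; first by rewrite linearB /= r1 s1 subrr.
by rewrite linearB /= fr fs.
Qed.

End Trace.
End PrimitiveChannel.

(** * Matrix product expectations as powers of the channel *)

Section TransferTrace.
Variables (R : realType) (d D : nat) (A : 'I_d -> 'M[R[i]]_D).
Notation C := R[i].

Definition word n (s : conf d n) : 'M[C]_D := \prod_(k < n) A (s k).

Lemma adj_basis_vec (be : 'I_D) : (basis_vec R be)^t* = delta_mx 0 be.
Proof. by rewrite trmx_delta map_delta_mx. Qed.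

(** In [conf_glue h p q] the first [N] letters come from [q] and the others from [p], hence the
    order of the factors. *)
Lemma word_glue N n (h : (N <= n)%N) p q :
  word (conf_glue h p q) = word q *m word (p : conf d (n - N)).
Proof.
have prod_cast m (e : (N + (n - N))%N = m) (F : 'I_m -> 'M[C]_D) :
    \prod_(k < m) F k = \prod_(k < N + (n - N)) F (cast_ord e k).
  by case: m / e F => F; apply: eq_bigr => k _; rewrite cast_ord_id.
rewrite /word (prod_cast _ (subnKC h)) big_split_ord /=.
have -> (Y Z : 'M[C]_D) : Y *m Z = Y * Z by [].
congr (_ * _); apply: eq_bigr => k _; rewrite ffunE cast_ordK.
  by rewrite (_ : lshift _ k = unsplit (inl k)) // unsplitK.
by rewrite (_ : rshift _ k = unsplit (inr k)) // unsplitK.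
Qed.

Definition conf_cons n (i : 'I_d) (p : conf d n) : conf d n.+1 :=
  [ffun k => if unlift ord0 k is Some j then p j else i].

Lemma word_cons n i (p : conf d n) : word (conf_cons i p) = A i *m word p.
Proof.
rewrite /word big_ord_recl ffunE unlift_none; congr (_ *m _).
by apply: eq_bigr => k _; rewrite ffunE liftK.
Qed.

Lemma sum_conf_cons (V : nmodType) n (F : conf d n.+1 -> V) :
  \sum_s F s = \sum_p \sum_i F (conf_cons i p).
Proof.
rewrite pair_big /= (reindex (fun x => conf_cons x.2 x.1)) //.
exists (fun s : conf d n.+1 =>
  ([ffun j : 'I_n => s (lift ord0 j)] : conf d n, s ord0)) => [[p i] _|s _] /=.
  congr (_, _); first by apply/ffunP => k; rewrite !ffunE liftK.
  by rewrite ffunE unlift_none.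
by apply/ffunP => k; rewrite ffunE; case: unliftP => [j ->|-> //]; rewrite ffunE.
Qed.

Lemma conf0_eq (s t : conf d 0) : s = t.
Proof. by apply/ffunP => -[]. Qed.

(** Kraus form of the powers. The first letter of a word stands next to [M], so it belongs to the
    innermost application; hence [iterSr] in the induction. *)
Lemma iter_channel n M :
  iter n (channel A) M = \sum_(p : conf d n) (word p)^t* *m M *m word p.
Proof.
elim: n M => [|n IH] M.
  (* Since [d] may be 0, no default letter exists and the empty configuration is built by
     eliminating the empty index type. *)
  pose s0 : conf d 0 := [ffun k : 'I_0 => match k with Ordinal _ h => match notF h with end end].
  rewrite (bigD1 s0) //= big1 ?addr0; last by move=> s /eqP []; apply: conf0_eq.
  by rewrite /word big_ord0 trmx1 map_mx1 mul1mx mulmx1.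
rewrite iterSr IH sum_conf_cons; apply: eq_bigr => p _.
rewrite mulmx_sumr mulmx_suml; apply: eq_bigr => i _.
by rewrite word_cons adjmxM !mulmxA.
Qed.

Lemma adj_word n (s : conf d n) :
  \prod_(k < n) (A (s (rev_ord k)))^t* = (word s)^t*.
Proof.
rewrite /word; elim: n s => [|n IH] s; first by rewrite !big_ord0 trmx1 map_mx1.
have -> : \prod_(k < n.+1) A (s k) =
    A (s ord0) *m \prod_(k < n) A ([ffun j => s (lift ord0 j)] k).
  by rewrite big_ord_recl; congr (_ *m _); apply: eq_bigr => k _; rewrite ffunE.
rewrite adjmxM -IH big_ord_recr /=; congr (_ *m _); last first.
  by rewrite (_ : rev_ord ord_max = ord0) //; apply: val_inj; rewrite /= subnn.
apply: eq_bigr => k _; rewrite ffunE; congr (_ ^t* ); congr (A (s _)).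
by apply: val_inj; rewrite /= /bump /= add1n subSn.
Qed.

Lemma hatE N (X : loc R d N) M : hat A X M =
  \sum_(s : conf d N) \sum_(t : conf d N)
    braket s X t *: ((word s)^t* *m M *m word t).
Proof.
by apply: eq_bigr => s _; apply: eq_bigr => t _; rewrite adj_word.
Qed.

Lemma mps_entry n (s : conf d n) : mps A n (enum_rank s) 0 = \tr (word s).
Proof. by rewrite mxE enum_rankK. Qed.

(** A matrix unit is a column times a row, so the entry factorises. This turns a product of two
    traces into entries of sandwiches, on which the channel acts. *)
Lemma sandwich_delta (Y Z : 'M[C]_D) al be :
  (Y^t* *m (delta_mx al be : 'M[C]_D) *m Z) al be = (Y al al)^* * Z be be.
Proof.
rewrite -(mul_delta_mx (0 : 'I_1)) !mulmxA -colE -mulmxA -rowE mxE big_ord1.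
by rewrite !mxE.
Qed.

Lemma trace_pair (x : C) (Y Z : 'M[C]_D) :
  (\tr Y)^* * x * \tr Z =
    \sum_(ab : 'I_D * 'I_D) x * (Y^t* *m delta_mx ab.1 ab.2 *m Z) ab.1 ab.2.
Proof.
rewrite -(pair_bigA _ (fun a b => x * (Y^t* *m delta_mx a b *m Z) a b)) /=.
rewrite /mxtrace rmorph_sum /= mulrAC mulrC big_distrlr /= mulr_sumr.
apply: eq_bigr => a _; rewrite mulr_sumr; apply: eq_bigr => b _.
by rewrite sandwich_delta.
Qed.

(** The first [N] letters sum up to [hat A X], the other [n - N] to a power of the channel. *)
Lemma mps_bracket N n (h : (N <= n)%N) (X : loc R d N) :
  ((mps A n)^t* *m emb h X *m mps A n) 0 0 =
    \sum_(ab : 'I_D * 'I_D)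
      iter (n - N) (channel A) (hat A X (delta_mx ab.1 ab.2)) ab.1 ab.2.
Proof.
(* The operator is diagonal in the last letters, so bra and ket share the tail [p]. *)
transitivity (\sum_(p : conf d (n - N)) \sum_(s : conf d N) \sum_(t : conf d N)
    (\tr (word s *m word p))^* * braket s X t * \tr (word t *m word p)).
  rewrite mxE sum_conf.
  under eq_bigr => t _.
    rewrite mxE sum_conf mps_entry.
    under eq_bigr => s _ do rewrite 2![in X in X * _]mxE mps_entry.
    over.
  rewrite (sum_glue h); apply: eq_bigr => p _.
  rewrite [RHS]exchange_big; apply: eq_bigr => t _.
  rewrite -mulr_suml; congr (_ * _); last by rewrite word_glue.
  rewrite (sum_glue h) (bigD1 p) //= [X in _ + X]big1 ?addr0; last first.
    move=> p' /negPf np; apply: big1 => s _.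
    by rewrite -[emb _ _ _ _]/(braket _ _ _) braket_glue np mulr0n mulr0.
  apply: eq_bigr => s _; rewrite word_glue.
  by rewrite -[emb _ _ _ _]/(braket _ _ _) braket_glue eqxx mulr1n.
under eq_bigr do under eq_bigr do under eq_bigr do rewrite trace_pair.
transitivity (\sum_(ab : 'I_D * 'I_D) \sum_(p : conf d (n - N))
    \sum_(s : conf d N) \sum_(t : conf d N) braket s X t *
    ((word s *m word p)^t* *m delta_mx ab.1 ab.2 *m (word t *m word p)) ab.1 ab.2).
  rewrite [RHS]exchange_big; apply: eq_bigr => p _.
  rewrite [RHS]exchange_big; apply: eq_bigr => s _.
  by rewrite [RHS]exchange_big.
apply: eq_bigr => ab _; rewrite iter_channel summxE; apply: eq_bigr => p _.
rewrite hatE mulmx_sumr mulmx_suml summxE; apply: eq_bigr => s _.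
rewrite mulmx_sumr mulmx_suml summxE; apply: eq_bigr => t _.
by rewrite -scalemxAr -scalemxAl [RHS]mxE adjmxM !mulmxA.
Qed.

Lemma braket1 n (s t : conf d n) : braket s (1%:M : loc R d n) t = (s == t)%:R.
Proof. by rewrite /braket mxE (inj_eq enum_rank_inj). Qed.

Lemma hat1 N M : hat A (1%:M : loc R d N) M = iter N (channel A) M.
Proof.
rewrite hatE iter_channel; apply: eq_bigr => s _.
rewrite (bigD1 s) //= big1 ?addr0 => [|t /negPf ts]; rewrite braket1.
  by rewrite eqxx scale1r.
by rewrite eq_sym ts scale0r.
Qed.

(** This is [mps_bracket] for the unit of the algebra on 0 sites. *)
Lemma mps_norm2E n : mps_norm2 A n =
  \sum_(ab : 'I_D * 'I_D) iter n (channel A) (delta_mx ab.1 ab.2) ab.1 ab.2.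
Proof.
have := mps_bracket (leq0n n) 1%:M; rewrite emb1 mulmx1 /mps_norm2 => ->.
by apply: eq_bigr => ab _; rewrite hat1 subn0.
Qed.

Lemma mps_state_local N n (h : (N <= n)%N) (X : loc R d N) :
  mps_state A (local_seq X n) =
    ((mps A n.+1)^t* *m emb (leqW h) X *m mps A n.+1) 0 0 / mps_norm2 A n.+1.
Proof. by rewrite /mps_state (local_seqE h) (emb_comp _ _ (leqW h)). Qed.

Lemma limit_valueE (rho : 'M[C]_D) N (X : loc R d N) :
  limit_value A rho X =
    \sum_(ab : 'I_D * 'I_D) \tr (hat A X (delta_mx ab.1 ab.2)) * rho ab.1 ab.2.
Proof.
rewrite -(pair_bigA _ (fun a b => \tr (hat A X (delta_mx a b)) * rho a b)) /=.
apply: eq_bigr => a _; apply: eq_bigr => b _.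
rewrite !adj_basis_vec mul_delta_mx mulrC; congr (_ * _).
by rewrite -rowE -colE !mxE.
Qed.

Lemma trace_delta_mx (al be : 'I_D) : \tr (delta_mx al be : 'M[C]_D) = (al == be)%:R.
Proof.
rewrite -(mul_delta_mx (0 : 'I_1)) mxtrace_mulC trace_mx11.
by rewrite mul_delta_mx_cond eq_sym; case: eqP; rewrite !mxE ?eqxx.
Qed.

Lemma sum_trace_delta (M : 'M[C]_D) :
  \sum_(ab : 'I_D * 'I_D) \tr (delta_mx ab.1 ab.2 : 'M[C]_D) * M ab.1 ab.2 = \tr M.
Proof.
rewrite -(pair_bigA _ (fun a b => \tr (delta_mx a b : 'M[C]_D) * M a b)) /=.
apply: eq_bigr => a _; rewrite (bigD1 a) //= big1 ?addr0 => [|b /negPf ba];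
  rewrite trace_delta_mx; first by rewrite eqxx mul1r.
by rewrite eq_sym ba mul0r.
Qed.

Lemma limit_value_one (rho : 'M[C]_D) :
  limit_value A rho (1%:M : loc R d 0) = \tr rho.
Proof.
rewrite limit_valueE -sum_trace_delta; apply: eq_bigr => ab _.
by rewrite hat1.
Qed.

Section Limit.
Variable rho : 'M[C]_D.
Hypotheses (tr_rho : \tr rho = 1)
  (cvg_rho : forall M i j, (fun n => iter n (channel A) M i j : C^o) @ \oo -->
    (\tr M * rho i j : C^o)).

(** The summands tend to the trace of a matrix unit times an entry of [rho], and these limits add up
    to [\tr rho]. *)
Lemma mps_norm2_cvg : (fun n => mps_norm2 A n : C^o) @ \oo --> (1 : C^o).
Proof.
rewrite -tr_rho -sum_trace_delta.
apply: (@cvgC_eventually _ (fun n => \sum_(ab : 'I_D * 'I_D)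
    iter n (channel A) (delta_mx ab.1 ab.2) ab.1 ab.2) _ 0).
  by move=> n _; rewrite mps_norm2E.
by apply: cvgC_sum => ab; apply: cvg_rho.
Qed.

Lemma mps_state_cvg N (X : loc R d N) :
  (fun n => mps_state A (local_seq X n) : C^o) @ \oo -->
    (limit_value A rho X : C^o).
Proof.
(* The exponent has [n.+1] because the state with index [n] is built on [n.+1] sites. *)
pose num n := \sum_(ab : 'I_D * 'I_D)
  iter (n.+1 - N) (channel A) (hat A X (delta_mx ab.1 ab.2)) ab.1 ab.2.
have cnum : (fun n => num n : C^o) @ \oo --> (limit_value A rho X : C^o).
  rewrite limit_valueE; apply: cvgC_sum => ab; apply/cvgCP => e e0.
  have /cvgCP/(_ e e0)[M HM] := @cvg_rho (hat A X (delta_mx ab.1 ab.2)) ab.1 ab.2.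
  by exists (M + N)%N => n Mn; apply: HM; lia.
have cden : (fun n => mps_norm2 A n.+1 : C^o) @ \oo --> (1 : C^o).
  apply/cvgCP => e e0; have /cvgCP/(_ e e0)[M HM] := mps_norm2_cvg.
  by exists M => n Mn; apply: HM; apply: leqW.
have cquo : (fun n => num n / mps_norm2 A n.+1 : C^o) @ \oo -->
    (limit_value A rho X / 1 : C^o).
  apply: cvgM; first exact: cnum.
  apply: cvgV; first exact: oner_neq0.
  exact: cden.
(* Below [N] the sequence [local_seq X] has its dummy value, so the formula is used from [N] on. *)
rewrite divr1 in cquo; apply: (@cvgC_eventually _ _ _ N _ _ cquo) => n Nn.
by rewrite (mps_state_local Nn) mps_bracket.
Qed.

End Limit.
End TransferTrace.

(* Transparent, it makes failing unifications of norms unfold the suprema. *)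
#[local] Opaque opnorm.

(** * Square roots of 1 - a, for small self-adjoint a, by iteration *)

Section StatesAreContinuous.
Variables (R : realType) (d : nat).
Notation C := R[i].

Lemma opnormZ_ge0 m n (s : R) (X : 'M[C]_(m, n)) : 0 <= s ->
  opnorm (s%:C%C *: X) <= s * opnorm X.
Proof.
move=> s0; apply: le_trans (opnormZ_le _ _) _.
by rewrite (_ : complex.Re `|s%:C%C| = s) // ger0_norm // ler0c.
Qed.

Section SquareRoot.
Variable n : nat.
Implicit Types b c z w : loc R d n.

(* A fixed point z satisfies (1 - z)^2 = 1 - b, and the step is a contraction on
   the ball of radius 1/4 when b lies in that ball. *)
Definition sqrt_step b z : loc R d n := (2^-1)%:C%C *: (b + z *m z).

Definition sqrt_iter b k := iter k (sqrt_step b) 0.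

(** Write zz - ww as z(z - w) + (z - w)w, with z and w of norm at most 1/4. The dependence on [b] is
    kept in order to compare different levels of a Cauchy sequence. *)
Lemma sqrt_step_dist b c z w : opnorm z <= 4^-1 -> opnorm w <= 4^-1 ->
  opnorm (sqrt_step b z - sqrt_step c w) <=
    2^-1 * (opnorm (b - c) + 2^-1 * opnorm (z - w)).
Proof.
move=> hz hw; rewrite -scalerBr (le_trans (opnormZ_ge0 _ _)) //.
rewrite ler_wpM2l //.
have -> : b + z *m z - (c + w *m w) = (b - c) + (z *m (z - w) + (z - w) *m w).
  by rewrite mulmxBr mulmxBl subrKA opprD addrACA.
have aux (x y u v t1 t2 t3 t : R) : x <= 4^-1 -> y <= 4^-1 -> 0 <= u ->
    t1 <= x * u -> t2 <= u * y -> t3 <= t1 + t2 -> t <= v + t3 ->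
    t <= v + 2^-1 * u by clear; nra.
exact (aux _ _ _ _ _ _ _ _ hz hw (opnorm_ge0 _) (opnormM _ _) (opnormM _ _)
  (opnormD _ _) (opnormD _ _)).
Qed.

Lemma sqrt_iter_le b k : opnorm b <= 4^-1 -> opnorm (sqrt_iter b k) <= 4^-1.
Proof.
move=> hb; have q0 : opnorm (0 : loc R d n) <= 4^-1 by rewrite opnorm0 invr_ge0.
elim: k => [|k IH]; first exact q0.
(* Comparison with 0, which is fixed by [sqrt_step 0]; the bound obtained is 3/16. *)
have := @sqrt_step_dist b 0 (sqrt_iter b k) 0 IH q0.
rewrite !subr0 /(sqrt_step 0 0) mulmx0 addr0 scaler0 subr0.
have aux (x y t : R) : x <= 4^-1 -> y <= 4^-1 -> t <= 2^-1 * (x + 2^-1 * y) ->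
  t <= 4^-1 by clear; lra.
exact (aux _ _ _ hb IH).
Qed.

(** The Lipschitz constant 1 is uniform in [k], since half of x + x/2 is below x. *)
Lemma sqrt_iter_dist b c k : opnorm b <= 4^-1 -> opnorm c <= 4^-1 ->
  opnorm (sqrt_iter b k - sqrt_iter c k) <= opnorm (b - c).
Proof.
move=> hb hc; elim: k => [|k IH]; first by rewrite subrr opnorm0 opnorm_ge0.
have aux (x y t : R) : 0 <= x -> y <= x -> t <= 2^-1 * (x + 2^-1 * y) ->
  t <= x by clear; lra.
exact (aux _ _ _ (opnorm_ge0 _) IH
  (sqrt_step_dist b c (sqrt_iter_le k hb) (sqrt_iter_le k hc))).
Qed.

Lemma sqrt_iter_cauchy b m k : opnorm b <= 4^-1 ->
  opnorm (sqrt_iter b (m + k) - sqrt_iter b m) <= 4^-1 ^+ m.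
Proof.
move=> hb; elim: m => [|m IH].
  rewrite subr0 expr0; apply: le_trans (sqrt_iter_le _ hb) _.
  by rewrite invf_le1 // ler1n.
have := sqrt_step_dist b b (sqrt_iter_le (m + k) hb) (sqrt_iter_le m hb).
rewrite subrr opnorm0 exprS.
have aux (p y t : R) : y <= p -> t <= 2^-1 * (0 + 2^-1 * y) -> t <= 4^-1 * p by clear; lra.
exact (aux _ _ _ IH).
Qed.

Lemma sqrt_iter_adj b k : b^t* = b -> (sqrt_iter b k)^t* = sqrt_iter b k.
Proof.
move=> hb; elim: k => [|k IH]; first by rewrite trmx0 map_mx0.
rewrite /= /sqrt_step -/(sqrt_iter b k) adjmxZ adjmxD adjmxM IH hb.
by rewrite geC0_conj // ler0c invr_ge0.
Qed.

(** The error of the approximate square root is twice one iteration step, hence geometrically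
    small. *)
Lemma sqrt_iter_defect b k :
  (1%:M - sqrt_iter b k) *m (1%:M - sqrt_iter b k) - (1%:M - b) =
    2%:C%C *: (sqrt_iter b k.+1 - sqrt_iter b k).
Proof.
rewrite /= /sqrt_step -/(sqrt_iter b k); set z := sqrt_iter b k.
rewrite scalerBr scalerA -rcM mulfV // scale1r mulmxBr mulmx1 mulmxBl mul1mx.
rewrite (_ : 2%:C%C = 1 + 1) ?scalerDl ?scale1r; last by rewrite -rmorphD.
rewrite (opprB 1%:M b) -(addrA 1%:M) -opprD [LHS]addrC subrKA addrA opprB.
by rewrite addrA.
Qed.

End SquareRoot.

Lemma emb_sqrt_iter m n (h : (m <= n)%N) (b : loc R d m) k :
  emb h (sqrt_iter b k) = sqrt_iter (emb h b) k.
Proof.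
elim: k => [|k IH]; first by rewrite linear0.
by rewrite /= /sqrt_step linearZ linearD /= embM IH.
Qed.

(* The n-th iterate is taken at level n, so that one sequence of local elements
   carries out both the approximation of a and the iteration. *)
Lemma qlocal_square (a : cseq R d) : (forall n, (val a n)^t* = val a n) ->
  (exists M, forall n, (M <= n)%N -> opnorm (val a n) <= 4^-1) ->
  exists u : qlocal R d, qstar u * u = 1 - qclass a.
Proof.
move=> ha [M0 hM0].
have q0 : 0 <= 4^-1 :> R by rewrite invr_ge0.
have q1 : 4^-1 < 1 :> R by rewrite invf_lt1 ?ltr1n.
pose y n : loc R d n := 1%:M - sqrt_iter (val a n) n.
have cy : cauchy_loc y.
  move=> e e0; have [M1 hM1] := cseqP a (half_pos e0).
  have [M2 hM2] := geometric_small 1 q0 q1 (half_pos e0).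
  exists (M0 + M1 + M2)%N => m n h Mm.
  have hMa : opnorm (val a n) <= 4^-1 by apply: hM0; lia.
  have hMb : opnorm (emb h (val a m)) <= 4^-1.
    by apply: le_trans (opnorm_emb _ _) _; apply: hM0; lia.
  rewrite /y linearB /= emb1 emb_sqrt_iter.
  set I : loc R d n := 1%:M; set z := sqrt_iter (val a n) n.
  (* The intermediate [v] separates the errors: [z - v] comes from the iteration, [v - w] from the
     approximation of [a]. *)
  set w := sqrt_iter _ m; pose v := sqrt_iter (val a n) m.
  have -> : I - z - (I - w) = - (z - v) - (v - w).
    by rewrite !opprB [LHS]addrC [RHS]addrC !subrKA.
  rewrite (le_lt_trans (opnormD _ _)) // !opnormN.
  have h1 : opnorm (z - v) <= e / 2.
    have := sqrt_iter_cauchy m (n - m) hMa; rewrite subnKC // => /le_trans; apply.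
    by have := hM2 m; rewrite mul1r; apply; lia.
  have h2 : opnorm (v - w) < e / 2.
    by apply: le_lt_trans (sqrt_iter_dist m hMa hMb) _; apply: hM1; lia.
  rewrite (splitr e); exact (ler_ltD h1 h2).
exists (qclass (Cseq cy)); rewrite qstarE.
rewrite -[LHS]/(qmul _ _) qmulE -scaleN1r.
rewrite -[RHS]/(qadd (qone R d) (qscale (-1) (qclass a))) qscaleE qaddE.
apply: qlocalP => e e0.
(* A quarter of [e]: [sqrt_iter_defect] doubles it, and the final inequality is strict. *)
have [M1 hM1] := geometric_small 1 q0 q1 (half_pos (half_pos e0)).
exists (M0 + M1)%N => n Mn /=.
rewrite /y adjmxB trmx1 map_mx1 sqrt_iter_adj // scaleN1r sqrt_iter_defect.
have hMa : opnorm (val a n) <= 4^-1 by apply: hM0; lia.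
have h1 := hM1 n (ltac:(lia)).
have h2 := sqrt_iter_cauchy n 1 hMa.
have h3 := opnormZ_ge0 (sqrt_iter (val a n) (n + 1) - sqrt_iter (val a n) n) (ler0n R 2).
move: h1 h2 h3; rewrite addn1 mul1r.
have aux (p x t : R) : p <= e / 2 / 2 -> x <= p -> t <= 2 * x -> t < e.
  by clear -e0; lra.
exact: aux.
Qed.

End StatesAreContinuous.

(** * Continuity of states *)

Section StateBounds.
Variables (R : realType) (d : nat).
Notation C := R[i].
Variable psi : qlocal R d -> C.
Hypothesis state_psi : is_state psi.

Lemma state_scale (a : C) u : psi (a *: u) = a * psi u.
Proof.
have [lpsi _ _] := state_psi; have z0 : psi 0 = 0.
  by have := lpsi (-1) 0 0; rewrite scaler0 addr0 mulN1r addNr.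
by rewrite -[a *: u]addr0 lpsi z0 addr0.
Qed.

Lemma state_add u v : psi (u + v) = psi u + psi v.
Proof. by have [lpsi _ _] := state_psi; rewrite -[u]scale1r lpsi mul1r scale1r. Qed.

Lemma qclass_scale (a : C) (x : cseq R d) : qclass (Defs.cscale a x) = a *: qclass x.
Proof. by rewrite -[RHS]/(qscale a (qclass x)) qscaleE. Qed.

Lemma qclass_add (x y : cseq R d) : qclass (Defs.cadd x y) = qclass x + qclass y.
Proof. by rewrite -[RHS]/(qadd (qclass x) (qclass y)) qaddE. Qed.

(** This forces the class of [x] to have norm at most [r] and avoids defining the norm of the
    quotient. *)
Definition eventually_le (x : cseq R d) (r : R) :=
  exists M, forall n, (M <= n)%N -> opnorm (val x n) <= r.

Definition self_adjoint (x : cseq R d) := forall n, (val x n)^t* = val x n.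

Lemma eventually_le_scale (a : C) (x : cseq R d) r :
  eventually_le x r -> eventually_le (Defs.cscale a x) (complex.Re `|a| * r).
Proof.
move=> [M HM]; exists M => n Mn; apply: (le_trans (opnormZ_le _ _)).
exact (ler_wpM2l (normC_ge0 a) (HM n Mn)).
Qed.

Lemma eventually_le_add (x y : cseq R d) r s :
  eventually_le x r -> eventually_le y s -> eventually_le (Defs.cadd x y) (r + s).
Proof.
move=> [M HM] [N HN]; exists (maxn M N) => n; rewrite geq_max => /andP[Mn Nn].
apply: (le_trans (opnormD _ _)); exact (lerD (HM n Mn) (HN n Nn)).
Qed.

Lemma eventually_le_adj (x : cseq R d) r :
  eventually_le x r -> eventually_le (cadj x) r.
Proof.
by move=> [M HM]; exists M => n Mn; exact (le_trans (opnorm_adj_le _) (HM n Mn)).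
Qed.

Lemma state_le1 (x : cseq R d) : self_adjoint x -> eventually_le x 4^-1 ->
  psi (qclass x) <= 1.
Proof.
move=> sx lx; have [u uE] := qlocal_square sx lx; have [_ ppsi psi1] := state_psi.
have := ppsi u; rewrite uE state_add psi1 -scaleN1r state_scale mulN1r.
by rewrite subr_ge0.
Qed.

Lemma normN1C : complex.Re `|-1 : C| = 1.
Proof. by rewrite normrN1. Qed.

Lemma state_norm_le1 (x : cseq R d) : self_adjoint x -> eventually_le x 4^-1 ->
  `|psi (qclass x)| <= 1.
Proof.
move=> sx lx; have h1 := state_le1 sx lx.
have := @state_le1 (Defs.cscale (-1) x); rewrite qclass_scale state_scale mulN1r => h2.
rewrite real_ler_norml ?h1 ?andbT.
  rewrite lerNl; apply: h2 => [n|].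
    by rewrite /= adjmxZ sx rmorphN1.
  by have := eventually_le_scale (-1) lx; rewrite normN1C mul1r.
(* The value is real, being 1 minus a number that [h1] makes nonnegative. *)
by rewrite -[X in X \is _](subKr 1) rpredB ?rpred1 ?ger0_real ?subr_ge0.
Qed.

Lemma state_self_adjoint_bound (x : cseq R d) (r : R) : 0 < r ->
  self_adjoint x -> eventually_le x r -> `|psi (qclass x)| <= (4 * r)%:C%C.
Proof.
(* Rescaling by [s] brings [x] into the ball of radius 1/4, where [state_norm_le1] applies. *)
move=> r0 sx lx; pose s : R := (4 * r)^-1.
have s0 : 0 < s by rewrite invr_gt0 mulr_gt0.
have nE : complex.Re `|s%:C%C : C| = s.
  by rewrite ger0_norm // ler0c ltW.
have := @state_norm_le1 (Defs.cscale s%:C%C x); rewrite qclass_scale state_scale.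
have sC0 : 0 <= s%:C%C :> C by rewrite ler0c ltW.
have rC0 : 0 <= (4 * r)%:C%C :> C by rewrite ler0c ltW // mulr_gt0.
rewrite normrM (ger0_norm sC0) => H.
have -> : `|psi (qclass x)| = (4 * r)%:C%C * (s%:C%C * `|psi (qclass x)|).
  by rewrite mulrA -rcM mulfV ?mul1r // gt_eqF // mulr_gt0.
rewrite -[leRHS]mulr1; apply: (ler_wpM2l rC0); apply: H => [n|].
  by rewrite /= adjmxZ sx geC0_conj.
have := eventually_le_scale s%:C%C lx; rewrite nE /s invfM -mulrA mulVf ?mulr1 //.
by rewrite gt_eqF.
Qed.

(** Both self-adjoint parts have norm at most 2r before halving, which gives (8r + 8r)/2. Any fixed
    multiple of [r] would serve for continuity. *)
Lemma state_bound (x : cseq R d) (r : R) : 0 < r ->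
  eventually_le x r -> `|psi (qclass x)| <= (8 * r)%:C%C.
Proof.
move=> r0 lx.
have [w [ww wc w1]] : exists w : C, [/\ w * w = -1, w^* = - w & `|w| = 1].
  by exists 'i; rewrite conjCi normCi -expr2 sqrCi.
pose h := Defs.cadd x (cadj x).
pose k := Defs.cscale w (Defs.cadd (cadj x) (Defs.cscale (-1) x)).
have lx' := eventually_le_adj lx.
have lh : eventually_le h (r + r) := eventually_le_add lx lx'.
have lk : eventually_le k (r + r).
  have := eventually_le_scale w (eventually_le_add lx' (eventually_le_scale (-1) lx)).
  by rewrite w1 normN1C !mul1r.
have sh : self_adjoint h by move=> n; rewrite /= adjmxD adjmxK addrC.
have sk : self_adjoint k.
  by move=> n; rewrite /= scaleN1r adjmxZ adjmxB adjmxK wc scaleNr -scalerN opprB.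
have -> : qclass x = (2^-1 : C) *: (w *: qclass k + qclass h).
  rewrite -(qclass_scale w k) -(qclass_add _ h) -qclass_scale; apply: qlocal_ext => n /=.
  by rewrite scaleN1r -adjmx_decomposition.
have r2 : 0 < r + r by rewrite addr_gt0.
rewrite state_scale state_add state_scale normrM.
have bh := state_self_adjoint_bound r2 sh lh.
have bk := state_self_adjoint_bound r2 sk lk.
have -> : (8 * r)%:C%C = `|2^-1 : C| * ((4 * (r + r))%:C%C + (4 * (r + r))%:C%C).
  rewrite ger0_norm ?invr_ge0 // -rmorphD.
  have -> : 8 * r = 2^-1 * (4 * (r + r) + 4 * (r + r)) by field.
  by rewrite rcM fmorphV rmorph_nat.
rewrite ler_wpM2l // (le_trans (ler_normD _ _)) // normrM w1 mul1r.
exact (lerD bk bh).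
Qed.

End StateBounds.

Lemma state_eq_on_local (R : realType) (d : nat) (psi phi : qlocal R d -> R[i]) :
  is_state psi -> is_state phi ->
  (forall N (X : loc R d N), psi (local_emb X) = phi (local_emb X)) -> psi = phi.
Proof.
move=> spsi sphi e_loc; apply: functional_extensionality_dep.
elim/qclassW => x; apply/eqP; rewrite -subr_eq0 -normr_eq0 -normCE.
set t := complex.Re _; rewrite (_ : t = 0) //; apply/eqP; rewrite eq_le normC_ge0 andbT.
rewrite leNgt; apply/negP => t0.
(* Each state contributes at most 8 times t/32 on the remainder [y], so the difference is at most
   t/2, against its norm [t]. *)
have e0 : 0 < t / 32 by rewrite divr_gt0.
have [M HM] := cseqP x e0.
pose l := Cseq (local_seq_cauchy (val x M)).
pose y := Defs.cadd x (Defs.cscale (-1) l).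
have ly : eventually_le y (t / 32).
  exists M => n Mn; rewrite /= scaleN1r (local_seqE Mn); exact (ltW (HM _ _ Mn (leqnn M))).
have yE f : is_state f -> f (qclass x) = f (qclass y) + f (local_emb (val x M)).
  move=> sf; rewrite qclass_add qclass_scale (state_add sf) (state_scale sf).
  by rewrite mulN1r subrK.
have : (t%:C%C : R[i]) <= (8 * (t / 32))%:C%C + (8 * (t / 32))%:C%C.
  rewrite normCE (yE _ spsi) (yE _ sphi) e_loc opprD addrACA subrr addr0.
  rewrite (le_trans (ler_normB _ _)) //.
  exact (lerD (state_bound spsi e0 ly) (state_bound sphi e0 ly)).
rewrite -rmorphD lecR; move: t0; clear; lra.
Qed.

(** * The limit functional and its extension to the completion *)

Section LimitState.
Variables (R : realType) (d D : nat) (A : 'I_d -> 'M[R[i]]_D) (rho : 'M[R[i]]_D).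
Notation C := R[i].

Lemma hat_linear N (a : C) (X Y : loc R d N) M :
  hat A (a *: X + Y) M = a *: hat A X M + hat A Y M.
Proof.
rewrite /hat scaler_sumr -big_split /=; apply: eq_bigr => s _.
rewrite scaler_sumr -big_split /=; apply: eq_bigr => t _.
by rewrite braket_linear scalerDl scalerA.
Qed.

Lemma limit_value_linear N (a : C) (X Y : loc R d N) :
  limit_value A rho (a *: X + Y) = a * limit_value A rho X + limit_value A rho Y.
Proof.
rewrite !limit_valueE mulr_sumr -big_split /=; apply: eq_bigr => ab _.
by rewrite hat_linear linearD linearZ /= mulrDl mulrA.
Qed.

Lemma limit_valueB N (X Y : loc R d N) :
  limit_value A rho (X - Y) = limit_value A rho X - limit_value A rho Y.
Proof.
have := limit_value_linear (-1) Y X.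
by rewrite scaleN1r mulN1r (addrC (- Y)) => ->; rewrite addrC.
Qed.

Lemma mps_norm2_sqr n : mps_norm2 A n = (l2norm (mps A n) ^+ 2)%:C%C.
Proof. exact: l2norm_dot. Qed.

Lemma mps_norm2_ge0 n : 0 <= mps_norm2 A n.
Proof. by rewrite mps_norm2_sqr ler0c exprn_ge0 ?l2norm_ge0. Qed.

(** The numerator is the squared norm of the embedded [X] applied to the matrix product vector. *)
Lemma mps_state_positive N n (h : (N <= n)%N) (X : loc R d N) :
  0 <= mps_state A (local_seq (X^t* *m X) n).
Proof.
rewrite (mps_state_local A h) divr_ge0 ?mps_norm2_ge0 // embM emb_adj.
rewrite (_ : _ *m mps A n.+1 = (emb (leqW h) X *m mps A n.+1)^t* *m
    (emb (leqW h) X *m mps A n.+1)); last by rewrite adjmxM !mulmxA.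
by rewrite l2norm_dot ler0c exprn_ge0 ?l2norm_ge0.
Qed.

Lemma mps_state_le_opnorm N n (h : (N <= n)%N) (X : loc R d N) :
  `|mps_state A (local_seq X n)| <= (opnorm X)%:C%C.
Proof.
rewrite (mps_state_local A h) normrM normfV (ger0_norm (mps_norm2_ge0 _)).
(* For a zero vector the quotient is 0, because the inverse of 0 is 0. *)
have [->|nz] := eqVneq (mps_norm2 A n.+1) 0.
  by rewrite invr0 mulr0 ler0c opnorm_ge0.
rewrite ler_pdivrMr ?lt_def ?nz ?mps_norm2_ge0 // mps_norm2_sqr -rcM -normCE lecR.
rewrite -mulmxA; apply: (le_trans (l2norm_CS _ _)).
have b : opnorm (emb (leqW h) X) * l2norm (mps A n.+1)
    <= opnorm X * l2norm (mps A n.+1) := ler_wpM2r (l2norm_ge0 _) (opnorm_emb _ X).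
rewrite expr2 mulrA [leRHS]mulrC; apply: (ler_wpM2l (l2norm_ge0 _)).
exact (le_trans (opnormP _ _) b).
Qed.

Hypothesis mps_cvg : forall N (X : loc R d N),
  (fun n => mps_state A (local_seq X n) : C^o) @ \oo --> (limit_value A rho X : C^o).
Hypothesis limit_value1 : limit_value A rho (1%:M : loc R d 0) = 1.

(** From level [n] on [X] and [emb h X] have the same [local_seq], so both values are limits of one
    sequence. *)
Lemma limit_value_emb N n (h : (N <= n)%N) (X : loc R d N) :
  limit_value A rho (emb h X) = limit_value A rho X.
Proof.
apply: (cvgC_unique (@mps_cvg _ _)).
apply: (@cvgC_eventually _ _ _ n _ _ (@mps_cvg _ X)) => m nm.
by rewrite (local_seqE nm) (emb_comp h nm (leq_trans h nm)) (local_seqE (leq_trans h nm)).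
Qed.

Lemma limit_value_positive N (X : loc R d N) : 0 <= limit_value A rho (X^t* *m X).
Proof.
by apply: (@cvgC_ge0 _ _ N _ _ (@mps_cvg _ _)) => n h; exact: mps_state_positive.
Qed.

Lemma limit_value_le_opnorm N (X : loc R d N) :
  `|limit_value A rho X| <= (opnorm X)%:C%C.
Proof.
rewrite -subr_ge0; pose f n := (opnorm X)%:C%C - `|mps_state A (local_seq X n)|.
apply: (@cvgC_ge0 _ f N) => [n h|]; first by rewrite subr_ge0 mps_state_le_opnorm.
apply/cvgCP => e e0; have /cvgCP/(_ e e0)[M HM] := @mps_cvg _ X.
exists M => n Mn; rewrite /f opprB addrC addrA subrK distrC.
exact: le_trans (ler_dist_dist _ _) (HM n Mn).
Qed.

Lemma limit_value_sub N n (h : (N <= n)%N) (X : loc R d n) (Y : loc R d N) :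
  limit_value A rho (X - emb h Y) = limit_value A rho X - limit_value A rho Y.
Proof.
by rewrite limit_valueB limit_value_emb.
Qed.

Lemma limit_value_cauchy (x : cseq R d) :
  exists a : C, (fun n => limit_value A rho (val x n) : C^o) @ \oo --> (a : C^o).
Proof.
apply: cauchyC_cvg => e e0; have [M HM] := cseqP x e0.
exists M => m n Mm h; rewrite -(limit_value_sub h).
apply: le_trans (limit_value_le_opnorm _) _; rewrite lecR.
exact (ltW (HM m n h Mm)).
Qed.

(** The limit exists by [limit_value_cauchy], so the default 0 of [xget] never arises. *)
Definition limit_state (u : qlocal R d) : C :=
  xget 0 [set a : C | (fun n => limit_value A rho (val (repr u) n) : C^o) @ \oo -->
    (a : C^o)].

(** Changing the representative adds a null sequence, on which [limit_value] tends to 0 because the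
    operator norm bounds it. *)
Lemma limit_stateP (x : cseq R d) :
  (fun n => limit_value A rho (val x n) : C^o) @ \oo -->
    (limit_state (qclass x) : C^o).
Proof.
have [a ca] := limit_value_cauchy (repr (qclass x)).
have : (fun n => limit_value A rho (val (repr (qclass x)) n) : C^o) @ \oo -->
    (limit_state (qclass x) : C^o).
  rewrite /limit_state; case: xgetP => [b _ //|/(_ a) []].
  exact: ca.
move: (limit_state _) => b cb; apply/cvgCP => e e0.
have e2 := half_pos e0.
have /cvgCP/(_ _ e2)[M HM] := cb; have [N HN] := cseq_reprP x e2.
exists (maxn M N) => n; rewrite geq_max => /andP[Mn Nn].
set y := val (repr (qclass x)) n in HM HN *.
have -> : limit_value A rho (val x n) - b =
    (limit_value A rho y - b) - limit_value A rho (y - val x n).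
  by rewrite limit_valueB opprB [RHS]addrC subrKA.
rewrite (splitr e) rmorphD; apply: (le_trans (ler_normB _ _)).
apply: lerD; first exact: HM.
apply: (le_trans (limit_value_le_opnorm _)); rewrite lecR; exact (ltW (HN n Nn)).
Qed.

Lemma limit_state_local N (X : loc R d N) :
  limit_state (local_emb X) = limit_value A rho X.
Proof.
apply: (cvgC_unique (@limit_stateP _)).
apply: (@cvgC_eventually _ (fun=> limit_value A rho X) _ N); last exact: cvg_cst.
by move=> n h; rewrite /= (local_seqE h) limit_value_emb.
Qed.

Lemma limit_state_is_state : is_state limit_state.
Proof.
split=> [a|u|].
- elim/qclassW => x; elim/qclassW => y; rewrite -qclass_scale -qclass_add.
  apply: (cvgC_unique (@limit_stateP _)).
  apply: (@cvgC_eventually _ (fun n => a * limit_value A rho (val x n)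
    + limit_value A rho (val y n)) _ 0).
    by move=> n _; rewrite /= limit_value_linear.
  apply: cvgD; last exact: limit_stateP.
  by apply: cvgM; [exact: cvg_cst|exact: limit_stateP].
- elim/qclassW: u => x; rewrite qstarE -[_ * _]/(qmul _ _) qmulE.
  by apply: (@cvgC_ge0 _ _ 0 _ _ (@limit_stateP _)) => n _; exact: limit_value_positive.
(* The unit is the image of the unit on 0 sites, where [limit_value1] gives the value. *)
by rewrite -(local_emb1 R d 0) limit_state_local.
Qed.

End LimitState.

Theorem theorem5p6 (R : realType) (d D : nat) (A : 'I_d -> 'M[R[i]]_D)
    (kappa : 'M[R[i]]_D)
    (hA : \sum_(i < d) A i *m (A i)^t* = 1%:M)
    (hPsi : forall n : nat, (1 <= n)%N -> mps_norm2 A n.+1 != 0)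
    (hkappa : is_markov_dobrushin (channel A) kappa)
    (kappa_ge0 : psdmx kappa) (kappa_neq0 : kappa != 0) :
  exists rho : 'M[R[i]]_D,
    [/\ is_density rho,
        channel A rho = rho,
        forall sigma : 'M[R[i]]_D,
          is_density sigma -> channel A sigma = sigma -> sigma = rho
      & exists phi : qlocal R d -> R[i],
          [/\ is_state phi,
              forall (N : nat) (X : loc R d N),
                (fun n : nat => (mps_state A (local_seq X n) : R[i]^o)) @ \oo
                  --> (phi (local_emb X) : R[i]^o),
              forall (N : nat) (X : loc R d N),
                phi (local_emb X) = limit_value A rho X
            & forall psi : qlocal R d -> R[i],
                is_state psi ->
                (forall (N : nat) (X : loc R d N),
                  (fun n : nat => (mps_state A (local_seq X n) : R[i]^o)) @ \oo
                    --> (psi (local_emb X) : R[i]^o)) ->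
                psi = phi]].
Proof.
have [rho drho frho] := channel_density_exists hA hkappa kappa_ge0 kappa_neq0.
have rho_cvg M i j : (fun n => iter n (channel A) M i j : R[i]^o) @ \oo -->
    (\tr M * rho i j : R[i]^o).
  exact: (@iter_channel_cvg _ _ _ _ hA _ hkappa kappa_ge0 kappa_neq0 rho M drho.2 frho i j).
have mps_cvg := @mps_state_cvg _ _ _ A rho drho.2 rho_cvg.
have one1 : limit_value A rho (1%:M : loc R d 0) = 1.
  by rewrite limit_value_one drho.2.
have loc_eq := @limit_state_local _ _ _ A rho mps_cvg.
exists rho; split=> //.
  by move=> sigma; apply: (channel_density_unique hA hkappa kappa_ge0 kappa_neq0).
have slim : is_state (limit_state A rho) := limit_state_is_state mps_cvg one1.
exists (limit_state A rho); split.
- exact slim.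
- by move=> N X; rewrite loc_eq; exact (@mps_cvg N X).
- exact loc_eq.
move=> psi spsi psi_cvg; apply: (state_eq_on_local spsi slim) => N X.
rewrite loc_eq; exact (cvgC_unique (@psi_cvg N X) (@mps_cvg N X)).
Qed.
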